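(* Let $X$ be a Banach space with a conditional spreading basis $(e_i)_i$, let $(z_i)_i$ be its convex block homogeneous part and let $Z=[(z_i)_i]$ be the closed linear span of $(z_i)_i$. Assume that $(z_i)_i$ is not equivalent to the summing basis of $c_0$. Then, if $X=Y\oplus W$, exactly one of the spaces $Y$ and $W$ contains a subspace that is isomorphic to $Z$. Furthermore, this one contains a subspace $\tilde Z$ isomorphic to $Z$ that is complemented in $X$.
   Context: Banach spaces are real. $X=Y\oplus W$ means that $Y,W$ are closed subspaces of $X$ with $Y\cap W=\{0\}$ and $Y+W=X$. Two sequences are equivalent if the norms of their finite linear combinations with the same coefficients are comparable up to uniform positive constants. A sequence is spreading (resp. 1-spreading) if it is equivalent (resp. isometrically equivalent) to all of its subsequences. A conditional spreading basis is a Schauder basis that is spreading and not unconditional. The summing basis of $c_0$ is the sequence of vectors $\sum_{j=1}^n\delta_j$, $n\in\mathbb{N}$, where $(\delta_j)_j$ is the unit vector basis of $c_0$. A convex block sequence of $(x_i)_i$ is a sequence $(w_k)_k$ with $w_k=\sum_{i\in F_k}c_ix_i$, where $F_1<F_2<\cdots$ are successive finite subsets of $\mathbb{N}$, $c_i\geqslant0$ and $\sum_{i\in F_k}c_i=1$. Convex block homogeneous part: let $(e_i)_i$ be a conditional spreading basis of $X$. After passing to an equivalent norm on $X$ with respect to which $(e_i)_i$ is 1-spreading (such a norm exists), let $Z$ be the completion of $c_{00}(\mathbb{N})$, with unit vector basis denoted $(z_i)_i$, under the norm $$\Big\|\sum_{i=1}^na_iz_i\Big\|=\lim_{N\to\infty}\Big\|\sum_{i=1}^na_i\Big(\frac1N\sum_{j=(i-1)N+1}^{iN}e_j\Big)\Big\|=\inf\Big\{\Big\|\sum_{i=1}^na_iw_i\Big\|:(w_i)_{i=1}^n\text{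 is a convex block sequence of }(e_i)_i\Big\}.$$ The sequence $(z_i)_i$, which is well defined up to equivalence, is the convex block homogeneous part of $(e_i)_i$. *)

(* Defs.v *)
From HB Require Import structures.
From mathcomp Require Import all_boot all_order all_algebra.
From mathcomp Require Import all_classical all_reals all_analysis.

Set Implicit Arguments.
Unset Strict Implicit.
Unset Printing Implicit Defensive.

Import Order.TTheory GRing.Theory Num.Theory.
Import numFieldNormedType.Exports.

Local Open Scope classical_set_scope.
Local Open Scope ring_scope.

(* All sequences are indexed from 0. *)

Definition lincomb (R : realType) (V : lmodType R) (x : nat -> V)
    (n : nat) (a : nat -> R) : V :=
  \sum_(i < n) a i *: x i.

(* The norms [N1], [N2] are explicit arguments, since sequences are compared
   under a renorming of a Banach space, and with a sequence of [c_0]. *)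
Definition seq_equivalent (R : realType) (V1 V2 : lmodType R)
    (N1 : V1 -> R) (x : nat -> V1) (N2 : V2 -> R) (y : nat -> V2) : Prop :=
  exists c C : R, [/\ 0 < c, 0 < C &
    forall n a, c * N1 (lincomb x n a) <= N2 (lincomb y n a) /\
                N2 (lincomb y n a) <= C * N1 (lincomb x n a)].

Definition seq_isometric (R : realType) (V1 V2 : lmodType R)
    (N1 : V1 -> R) (x : nat -> V1) (N2 : V2 -> R) (y : nat -> V2) : Prop :=
  forall n a, N1 (lincomb x n a) = N2 (lincomb y n a).

Definition strictly_increasing (phi : nat -> nat) : Prop :=
  {homo phi : m n / (m < n)%N}.

Definition spreading (R : realType) (V : lmodType R)
    (N : V -> R) (x : nat -> V) : Prop :=
  forall phi, strictly_increasing phi -> seq_equivalent N x N (x \o phi).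

Definition one_spreading (R : realType) (V : lmodType R)
    (N : V -> R) (x : nat -> V) : Prop :=
  forall phi, strictly_increasing phi -> seq_isometric N x N (x \o phi).

Definition expansion (R : realType) (X : normedModType R) (e : nat -> X)
    (a : nat -> R) (x : X) : Prop :=
  series (fun i => a i *: e i) @ \oo --> x.

Definition schauder_basis (R : realType) (X : normedModType R)
    (e : nat -> X) : Prop :=
  forall x, exists! a, expansion e a x.

(* Every expansion converges unconditionally, i.e. all its rearrangements
   converge. *)
Definition unconditional_basis (R : realType) (X : normedModType R)
    (e : nat -> X) : Prop :=
  schauder_basis e /\
  forall a x, expansion e a x ->
  forall s : nat -> nat, bijective s ->
    cvg (series (fun i => a (s i) *: e (s i)) @ \oo).

Definition conditional_spreading_basis (R : realType) (X : normedModType R)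
    (e : nat -> X) : Prop :=
  [/\ schauder_basis e, spreading (fun v : X => `|v|) e
    & ~ unconditional_basis e].

Definition equivalent_norm (R : realType) (X : normedModType R)
    (N : X -> R) : Prop :=
  [/\ forall x y, N (x + y) <= N x + N y,
      forall (a : R) x, N (a *: x) = `|a| * N x
    & exists c C : R, [/\ 0 < c, 0 < C &
        forall x, c * `|x| <= N x /\ N x <= C * `|x|]].

Definition block_average (R : realType) (V : lmodType R) (e : nat -> V)
    (m i : nat) : V :=
  m%:R^-1 *: \sum_(i * m <= j < i.+1 * m) e j.

(* The completion of [c_00] under the limit norm is realized, up to isometry,
   as the closed linear span of a sequence [z] of a Banach space [E] on whose
   finite linear combinations the norm of [E] is that limit. *)
Definition convex_block_homogeneous_part (R : realType)
    (X : normedModType R) (e : nat -> X)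
    (E : normedModType R) (z : nat -> E) : Prop :=
  exists N : X -> R, [/\ equivalent_norm N, one_spreading N e &
    forall n a,
      N (lincomb (block_average e m) n a) @[m --> \oo] --> `|lincomb z n a|].

Definition closed_span (R : realType) (E : normedModType R) (z : nat -> E) :
    set E :=
  closure [set x | exists n a, x = lincomb z n a].

Definition c0 (R : realType) : set (nat -> R) := [set u | u @ \oo --> 0].

(* The supremum norm; [sup] is the actual supremum on [c0], whose elements are
   bounded. *)
Definition c0_norm (R : realType) (u : nat -> R) : R :=
  sup (range (fun k => `|u k|)).

Definition delta (R : realType) (j : nat) : nat -> R := fun k => (k == j)%:R.

Definition summing_basis (R : realType) (n : nat) : nat -> R :=
  \sum_(j < n.+1) delta R j.

Lemma c0_summing_basis (R : realType) n : @c0 R (summing_basis R n).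
Proof.
apply: cvg_near_cst; exists n.+1 => // k /= nk.
rewrite /summing_basis fct_sumE big1 // => j _.
by rewrite /delta gtn_eqF // (leq_trans (ltn_ord j)).
Qed.

Definition closed_subspace (R : realType) (X : normedModType R)
    (A : set X) : Prop :=
  closed A /\ submod_closed (mem A).

Definition direct_sum (R : realType) (X : normedModType R)
    (Y W : set X) : Prop :=
  [/\ closed_subspace Y, closed_subspace W, Y `&` W = [set 0]
    & [set y + w | y in Y & w in W] = [set: X]].

Definition complemented (R : realType) (X : normedModType R)
    (A : set X) : Prop :=
  exists B, direct_sum A B.

Definition linear_on (R : realType) (V V' : lmodType R) (A : set V)
    (f : V -> V') : Prop :=
  forall (a : R) x y, A x -> A y -> f (a *: x + y) = a *: f x + f y.

(* [f] and [g] are meaningful only on [A] and [B] respectively. *)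
Definition isomorphic (R : realType) (V V' : normedModType R)
    (A : set V) (B : set V') : Prop :=
  exists (f : V -> V') (g : V' -> V),
    [/\ linear_on A f, set_fun A B f, set_fun B A g,
        {in A, cancel f g} /\ {in B, cancel g f}
      & {within A, continuous f} /\ {within B, continuous g}].

Definition contains_copy (R : realType) (X E : normedModType R)
    (A : set X) (Z : set E) : Prop :=
  exists2 Z' : set X, Z' `<=` A & closed_subspace Z' /\ isomorphic Z' Z.

Definition contains_complemented_copy (R : realType) (X E : normedModType R)
    (A : set X) (Z : set E) : Prop :=
  exists2 Z' : set X, Z' `<=` A &
    [/\ closed_subspace Z', isomorphic Z' Z & complemented Z'].

(* Main.v *)
(* Let s be the sum of the coefficients with respect to (e_i). Shifting the blocks
   of a finite combination inside long windows and averaging shows that collapsing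
   the indices along any nondecreasing kappa is bounded: e_i |-> z_(kappa i) extends
   to an operator from X to Z, and blocks with s = 0 are unconditional. Since Z is
   not l_1, suitable convex blocks w_k of (e_i) satisfy |sum a_k w_k| <= C |sum a_k z_k|.

   For a bounded sequence (x_k) let beta be the part of s(x_k) that escapes to
   infinity, i.e. lim s(x_k) minus the sum of the coordinatewise limit (limits along
   a free ultrafilter). A gliding hump writes a subsequence as
   V + sum_(j < l) A_j + B_l up to a small error, where A_j, B_j live on successive
   blocks, s(A_j) = 0 and s(B_j) = beta.
   - If (x_k) is dominated by (z_k) and beta <> 0, the collapsing operator of the
     blocks almost inverts z_l |-> x_l / beta, so [x_l] is a complemented copy of Z.
   - If (x_k) is equivalent to (z_k) then beta <> 0: otherwise averaging kills the
     unconditional sequence B, and (z_k) is dominated by, hence equivalent to, the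
     summing basis.
   The convex blocks w_k have beta = 1, so for the projection P onto Y one of (P w_k),
   (w_k - P w_k) has beta <> 0, which gives a complemented copy in Y or in W. Copies
   (x_k) in Y and (x'_k) in W would have a combination a x_k + x'_k, still equivalent
   to (z_k), with beta = 0. *)

Require Import Defs.
From mathcomp Require Import all_boot all_order all_algebra.
From mathcomp Require Import all_classical all_reals all_analysis.
From mathcomp Require Import zify ring lra.

Set Implicit Arguments.
Unset Strict Implicit.
Unset Printing Implicit Defensive.

Import Order.TTheory GRing.Theory Num.Theory.
Import numFieldNormedType.Exports.

Local Open Scope classical_set_scope.
Local Open Scope ring_scope.

(** * Seminorms and averaging *)

(** All limits are taken along one fixed free ultrafilter because beta has to be linear on bounded
    sequences at once: the identity beta(P w) + beta(w - P w) = 1 and the cancellation in a x_k +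
    x'_k rest on this. The functional s is bounded on X because collapsing all indices to one sends
    x to s(x) z_0, and z_0 <> 0: otherwise every block could be suppressed and (e_i) would be
    unconditional. Conditionality also excludes l_1, since a lower l_1 estimate for (e_i) would
    bound all restrictions to sets of indices. Tail sums are bounded on Z, so (z_k) always dominates
    the summing basis; this is why domination in the other direction already gives equivalence.
    Window averages are the right tool because the norm of Z is itself a limit of norms of window
    averages, so averaged blocks become multiples of the z_k as the windows grow. The 1-spreading
    norm serves to shift blocks without changing norms; the resulting estimates are transferred to
    the given norm with a single constant in [homogeneous_basis]. *)

Section Seminorm.
Variables (R : realType) (V : lmodType R).

Definition seminorm (N : V -> R) : Prop :=
  (forall x y, N (x + y) <= N x + N y) /\
  (forall (a : R) x, N (a *: x) = `|a| * N x).

Variable N : V -> R.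
Hypothesis SN : seminorm N.

Lemma sn_add x y : N (x + y) <= N x + N y. Proof. exact: SN.1. Qed.

Lemma sn_scale (a : R) x : N (a *: x) = `|a| * N x. Proof. exact: SN.2. Qed.

Lemma sn0 : N 0 = 0.
Proof. by rewrite -(scale0r 0) sn_scale normr0 mul0r. Qed.

Lemma snN x : N (- x) = N x.
Proof. by rewrite -scaleN1r sn_scale normrN normr1 mul1r. Qed.

Lemma sn_ge0 x : 0 <= N x.
Proof.
have := sn_add x (- x); rewrite subrr sn0 snN; lra.
Qed.

Lemma sn_sub x y : N (x - y) <= N x + N y.
Proof. by rewrite -(snN y) sn_add. Qed.

Lemma sn_dist x y : N x <= N y + N (x - y).
Proof. by rewrite -{1}(subrK y x) addrC sn_add. Qed.

Lemma sn_sum (I : Type) (r : seq I) (P : pred I) (F : I -> V) :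
  N (\sum_(i <- r | P i) F i) <= \sum_(i <- r | P i) N (F i).
Proof.
elim/big_ind2: _ => [|x1 x2 y1 y2 h1 h2|//]; first by rewrite sn0.
by apply: (le_trans (sn_add _ _)); apply: lerD.
Qed.

Lemma sn_convex m (c : nat -> R) (y : nat -> V) M :
  (forall j, 0 <= c j) -> \sum_(j < m) c j = 1 ->
  (forall j, (j < m)%N -> N (y j) <= M) -> N (\sum_(j < m) c j *: y j) <= M.
Proof.
move=> c0 c1 yM; rewrite -(mul1r M) -c1 mulr_suml.
apply: (le_trans (sn_sum _ _ _)); apply: ler_sum => j _.
by rewrite sn_scale ger0_norm// ler_wpM2l// yM.
Qed.

Lemma sn_average m (y : nat -> V) M : (0 < m)%N ->
  (forall j, (j < m)%N -> N (y j) <= M) -> N (m%:R^-1 *: \sum_(j < m) y j) <= M.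
Proof.
move=> m0 yM; rewrite scaler_sumr; apply: (sn_convex (c := fun=> m%:R^-1)) => //.
by rewrite sumr_const card_ord -[LHS]mulr_natr mulVf// pnatr_eq0 -lt0n//.
Qed.

(** Convexity is applied to one block at a time; the offset [v] holds the blocks already frozen at a
    single vector, so that the induction on [n] closes. *)
Lemma sn_convex_blocks n (m : nat -> nat) (c : nat -> nat -> R)
    (y : nat -> nat -> V) M v :
  (forall k j, 0 <= c k j) -> (forall k, \sum_(j < m k) c k j = 1) ->
  (forall g : nat -> nat, (forall k, g k < m k)%N ->
     N (v + \sum_(k < n) y k (g k)) <= M) ->
  N (v + \sum_(k < n) \sum_(j < m k) c k j *: y k j) <= M.
Proof.
move=> c0 c1; elim: n v => [|n IH] v yM.
  rewrite big_ord0; have /choice[g gm] : forall k, exists j, (j < m k)%N.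
    move=> k; exists 0%N; case: (m k) (c1 k) => [|//].
    by rewrite big_ord0 => /eqP; rewrite eq_sym oner_eq0.
  by have := yM g gm; rewrite big_ord0.
rewrite big_ord_recr/= addrA.
set w := v + _.
have -> : w + \sum_(j < m n) c n j *: y n j = \sum_(j < m n) c n j *: (w + y n j).
  under [RHS]eq_bigr do rewrite scalerDr.
  by rewrite big_split/= -scaler_suml c1 scale1r.
apply: (sn_convex (y := fun j => w + y n j)) => // j jm.
rewrite /w addrAC; apply: IH => g gm.
pose g' k := if k == n then j else g k.
have g'm k : (g' k < m k)%N by rewrite /g'; case: eqP => // ->.
have := yM g' g'm; rewrite big_ord_recr/= (_ : g' n = j) ?/g' ?eqxx//.
rewrite (eq_bigr (fun k : 'I_n => y k (g k))) => [|k _]; last first.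
  by rewrite ltn_eqF.
by rewrite addrA addrAC.
Qed.

(** The cube is the convex hull of its vertices: [d j] weighs the two vectors [0] and [v j], and
    choosing one of them for each [j] amounts to a subset [D]. *)
Lemma sn_multipliers01 n (d : nat -> R) (v : nat -> V) M :
  (forall D : pred nat, N (\sum_(j < n | D j) v j) <= M) ->
  (forall j, 0 <= d j <= 1) -> N (\sum_(j < n) d j *: v j) <= M.
Proof.
move=> vM d01.
pose y k (j : nat) := if j == 0%N then 0 else v k.
pose c k (j : nat) := if j == 0%N then 1 - d k else d k.
have -> : \sum_(j < n) d j *: v j = 0 + \sum_(k < n) \sum_(j < 2) c k j *: y k j.
  rewrite add0r; apply: eq_bigr => k _.
  by rewrite !big_ord_recl big_ord0/= scaler0 add0r addr0.
apply: (sn_convex_blocks (m := fun=> 2%N)).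
- by move=> k j; rewrite /c; case: eqP; have /andP[] := d01 k; lra.
- by move=> k; rewrite !big_ord_recl big_ord0/= /c/=; lra.
- move=> g g2; rewrite add0r.
  rewrite (_ : \sum_(k < n) _ = \sum_(k < n | g k != 0%N) v k) ?vM //.
    exact: (vM (fun k => g k != 0%N)).
  by rewrite [RHS]big_mkcond/=; apply: eq_bigr => k _; rewrite /y; case: eqP.
Qed.

(** The positive and negative parts of [d / m] are multipliers in [0,1], hence the factor 2. For
    [m = 0] division by zero gives [p = q = 0], consistent with [d = 0]. *)
Lemma sn_multipliers n (d : nat -> R) (v : nat -> V) M m : 0 <= m ->
  (forall D : pred nat, N (\sum_(j < n | D j) v j) <= M) ->
  (forall j, `|d j| <= m) -> N (\sum_(j < n) d j *: v j) <= 2 * M * m.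
Proof.
move=> m0 vM dm.
pose p j := Num.max (d j) 0 / m; pose q j := Num.max (- d j) 0 / m.
have dE j : d j = m * (p j - q j).
  have := dm j; rewrite /p /q; have [->|mN0 _] := eqVneq m 0.
    by rewrite normr_le0 => /eqP ->; rewrite mul0r.
  rewrite -mulrBl mulrCA mulfV// mulr1.
  by case: (lerP (d j) 0) => dj; case: (lerP (- d j) 0); lra.
have p01 j : 0 <= p j <= 1 /\ 0 <= q j <= 1.
  have /ler_normlP[] := dm j; rewrite /p /q => dm1 dm2.
  have [->|mN0] := eqVneq m 0; first by rewrite invr0 !mulr0 lexx ler01.
  have mgt0 : 0 < m by rewrite lt_neqAle eq_sym mN0.
  rewrite !divr_ge0 ?le_max ?lexx ?orbT//= !ler_pdivrMr// mul1r.
  by rewrite !ge_max m0 dm1 dm2.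
have -> : \sum_(j < n) d j *: v j =
    m *: (\sum_(j < n) p j *: v j - \sum_(j < n) q j *: v j).
  rewrite -sumrB scaler_sumr; apply: eq_bigr => j _.
  by rewrite -scalerBl scalerA -dE.
rewrite sn_scale ger0_norm// mulrC ler_wpM2r//.
apply: (le_trans (sn_sub _ _)); rewrite mulr2n mulrDl mul1r.
by apply: lerD; apply: sn_multipliers01 => // j; have [] := p01 j.
Qed.

Lemma sn_abs_multipliers n (c : nat -> R) (v : nat -> V) :
  (forall D : pred nat, N (\sum_(j < n | D j) c j *: v j) <=
                        N (\sum_(j < n) c j *: v j)) ->
  N (\sum_(j < n) `|c j| *: v j) <= 2 * N (\sum_(j < n) c j *: v j).
Proof.
move=> H; have := @sn_multipliers n (fun j => Num.sg (c j)) (fun j => c j *: v j)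
  _ 1 ler01 H.
rewrite mulr1 (eq_bigr (fun j : 'I_n => `|c j| *: v j)); last first.
  by move=> j _; rewrite scalerA -normrEsg.
apply => j; rewrite normr_sg; by case: (_ != _).
Qed.
End Seminorm.

(** * Spreading sequences *)

Lemma big_blocks (V : nmodType) (p : nat -> nat) n (F : nat -> V) : {homo p : i j / (i <=
  j)%N} ->
  \sum_(p 0 <= i < p n) F i = \sum_(k < n) \sum_(p k <= i < p k.+1) F i.
Proof.
move=> pm; elim: n => [|n IH]; first by rewrite big_geq// big_ord0.
by rewrite big_ord_recr/= -IH -big_cat_nat//=; apply: pm.
Qed.

Section Lincomb.
Variables (R : realType) (V : lmodType R).

Lemma lincomb_nat (x : nat -> V) n a :
  lincomb x n a = \sum_(0 <= i < n) a i *: x i.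
Proof. by rewrite big_mkord. Qed.

Lemma lincomb_reindex (x : nat -> V) (f : nat -> nat) n K (a : nat -> R) :
  (forall i, (i < n)%N -> (f i < K)%N) ->
  \sum_(i < n) a i *: x (f i) =
  lincomb x K (fun k => \sum_(i < n | f i == k) a i).
Proof.
move=> fK; rewrite /lincomb.
under [RHS]eq_bigr do rewrite scaler_suml.
rewrite (exchange_big_dep xpredT)//=; apply: eq_bigr => i _.
rewrite (bigD1 (Ordinal (fK i (ltn_ord i))))//= [X in _ = _ + X]big1 ?addr0//.
move=> k /andP[/eqP fik]; rewrite -val_eqE/= fik; by rewrite eqxx.
Qed.

Lemma lincomb_block_average (x : nat -> V) m n a :
  lincomb (block_average x m) n a =
  lincomb x (n * m) (fun t => a (t %/ m)%N / m%:R).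
Proof.
rewrite [RHS]lincomb_nat big_nat_mul lincomb_nat.
apply: eq_big_nat => i /andP[_ _]; rewrite /block_average scalerA scaler_sumr.
apply: eq_big_nat => j /andP[ij ji]; congr (a _ / _ *: _).
have m0 : (0 < m)%N by case: (m) ij ji => [|//]; rewrite !muln0.
apply/eqP; rewrite eqn_leq leq_divRL// ij -ltnS ltn_divLR// ji //.
Qed.

End Lincomb.

Section Spreading.
Variables (R : realType) (V : lmodType R) (N : V -> R) (x : nat -> V).
Hypotheses (SN : seminorm N) (OS : one_spreading N x).

Lemma one_spreading_fin n (f : nat -> nat) (a : nat -> R) :
  (forall i, (i.+1 < n)%N -> (f i < f i.+1)%N) ->
  N (\sum_(i < n) a i *: x (f i)) = N (lincomb x n a).
Proof.
move=> fS; pose g i := if (i < n)%N then f i else (f n.-1 + i)%N.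
have gS : strictly_increasing g.
  apply: homo_ltn => [? ? ?|i]; first exact: ltn_trans.
  rewrite /g; case: (ltnP i.+1 n) => [in1|].
    by rewrite (ltnW in1) fS.
  rewrite leq_eqVlt => /orP[/eqP ->|]; [by rewrite ltnSn /=; lia | rewrite ltnS => ni;
    rewrite (ltnNge i) ni/=; lia].
rewrite (OS gS) /lincomb; congr N; apply: eq_bigr => i _ /=.
by rewrite /g ltn_ord.
Qed.

Lemma one_spreading_term i : N (x i) = N (x 0).
Proof.
have := @one_spreading_fin 1 (fun=> i) (fun=> 1).
by rewrite /lincomb !big_ord1 !scale1r => ->.
Qed.

(** The two averages share the vectors of the short window, with weights 1/T and 1/L. This
    discrepancy and the other T - L vectors each contribute at most the fraction (T - L) / T of
    [N (x 0)]. *)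
Lemma block_average_shift (q i L T : nat) : (i + L <= T)%N -> (0 < L)%N ->
  N (T%:R^-1 *: (\sum_(j < T) x (q + j)) - L%:R^-1 *: \sum_(j < L) x (q + i + j))
   <= 2 * (T - L)%:R * N (x 0) / T%:R.
Proof.
move=> iLT L0; set B := N (x 0).
have T0 : (0 < T)%N by lia.
have -> : \sum_(j < T) x (q + j) = \sum_(0 <= j < i) x (q + j) +
   \sum_(j < L) x (q + i + j) + \sum_(i + L <= j < T) x (q + j).
  rewrite -(big_mkord xpredT (fun j => x (q + j)%N)) (big_cat_nat _ (n := i + L))//=.
  rewrite (big_cat_nat _ (n := i) (p := i + L))//= ?leq_addr//; congr (_ + _ + _).
  rewrite -{1}(add0n i) big_addn addKn big_mkord; apply: eq_bigr => j _.
  by congr x; lia.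
set S1 := \sum_(0 <= j < i) _; set S2 := \sum_(j < L) _.
set S3 := \sum_(_ <= j < _) _.
have -> : T%:R^-1 *: (S1 + S2 + S3) - L%:R^-1 *: S2 =
    T%:R^-1 *: (S1 + S3) - (L%:R^-1 - T%:R^-1) *: S2.
  by rewrite addrAC scalerDr scalerBl opprB addrA.
have h (r : seq nat) (f : nat -> nat) :
    N (\sum_(j <- r) x (f j)) <= (size r)%:R * B.
  apply: (le_trans (sn_sum SN _ _ _)).
  under eq_bigr do rewrite one_spreading_term.
  by rewrite big_const_seq count_predT iter_addr_0 mulr_natl.
have TL : T%:R^-1 <= L%:R^-1 :> R by rewrite lef_pV2 ?posrE ?ltr0n// ler_nat; lia.
have S2B : N S2 <= L%:R * B.
  by rewrite /S2 -(big_mkord xpredT (fun j => x (q + i + j)%N)) (le_trans (h _ _))// size_iota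
    subn0.
have S1B : N S1 <= i%:R * B by rewrite (le_trans (h _ _))// size_iota subn0.
have S3B : N S3 <= (T - (i + L))%:R * B by rewrite (le_trans (h _ _))// size_iota.
apply: (le_trans (sn_sub SN _ _)); rewrite !(sn_scale SN) !ger0_norm ?subr_ge0//.
apply: (@le_trans _ _ (T%:R^-1 * ((T - L)%:R * B) + (L%:R^-1 - T%:R^-1) * (L%:R * B))).
  apply: lerD; last by rewrite ler_wpM2l// subr_ge0.
  rewrite ler_wpM2l ?invr_ge0// (le_trans (sn_add SN _ _))//.
  apply: (le_trans (lerD S1B S3B)); rewrite -mulrDl -natrD.
  by rewrite (_ : (i + _)%N = (T - L)%N)//; lia.
rewrite natrB; last by lia.
rewrite le_eqVlt; apply/orP; left; apply/eqP.
field; rewrite !pnatr_eq0; lia.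
Qed.

(* Shifting the blocks in [D] by j < T - n inside disjoint windows of length T
   leaves the norm unchanged; averaging over j replaces each vector of such a
   block by the average of its window. *)
Lemma collapse n (a : nat -> R) (kappa : nat -> nat) (D : pred nat) T :
  {homo kappa : i j / (i <= j)%N} -> (n < T)%N ->
  N (\sum_(i < n | ~~ D (kappa i)) a i *: x (kappa i * T + i) +
     \sum_(i < n | D (kappa i)) a i *: block_average x T (kappa i)) <=
  N (lincomb x n a) + (\sum_(i < n) `|a i|) * (2 * n%:R * N (x 0) / T%:R).
Proof.
move=> km nT; pose L := (T - n)%N.
have L0 : (0 < L)%N by rewrite subn_gt0.
pose f j i := (kappa i * T + i + (if D (kappa i) then j else 0))%N.
have fN j : (j < L)%N -> N (\sum_(i < n) a i *: x (f j i)) = N (lincomb x n a).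
  move=> jL; apply: one_spreading_fin => i iN; rewrite /f.
  have := km i i.+1 (leqnSn i); rewrite leq_eqVlt => /orP[/eqP <-|]; first by lia.
  move=> kk; have : (kappa i * T + T <= kappa i.+1 * T)%N.
    by rewrite -mulSnr leq_mul2r kk orbT.
  by case: ifP; case: ifP; rewrite /L in jL; lia.
set lhs := (X in N X).
apply: (le_trans (sn_dist SN lhs (L%:R^-1 *: \sum_(j < L) \sum_(i < n) a i *: x (f j i)))).
apply: lerD.
  apply: (sn_average SN (y := fun j => \sum_(i < n) a i *: x (f j i))) => // j jL.
  by rewrite fN.
have -> : L%:R^-1 *: (\sum_(j < L) \sum_(i < n) a i *: x (f j i)) =
   \sum_(i < n | ~~ D (kappa i)) a i *: x (kappa i * T + i) +
   \sum_(i < n | D (kappa i)) a i *: (L%:R^-1 *: \sum_(j < L) x (kappa i * T + i + j)).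
  rewrite exchange_big/= scaler_sumr (bigID (fun i : 'I_n => D (kappa i)))/= addrC.
  congr (_ + _); apply: eq_bigr => i Di; rewrite /f.
    rewrite (negbTE Di) addn0 sumr_const card_ord -[(a i *: _) *+ L]scaler_nat !scalerA.
    by rewrite mulrA mulVf ?mul1r// pnatr_eq0; lia.
  by rewrite Di -scaler_sumr !scalerA mulrC.
rewrite /lhs opprD addrACA subrr add0r -sumrB.
apply: (le_trans (sn_sum SN _ _ _)).
rewrite mulr_suml [leRHS](bigID (fun i : 'I_n => D (kappa i)))/= -[leLHS]addr0.
apply: lerD; last first.
  apply: sumr_ge0 => i _; rewrite !mulr_ge0 ?invr_ge0//; exact: sn_ge0.
apply: ler_sum => i _; rewrite -scalerBr (sn_scale SN) ler_wpM2l//.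
have -> : block_average x T (kappa i) = T%:R^-1 *: \sum_(j < T) x (kappa i * T + j).
  rewrite /block_average; congr (_ *: _).
  rewrite -{1}(add0n (kappa i * T)%N) big_addn -mulnBl subSnn mul1n big_mkord.
  by apply: eq_bigr => j _; rewrite addnC.
apply: (le_trans (@block_average_shift _ i L T _ _)) => //; first by rewrite /L;
  have := ltn_ord i; lia.
by rewrite (_ : (T - L)%N = n) // /L; lia.
Qed.
End Spreading.

(** * The homogeneous part *)

Lemma le_of_cvg_harmonic (R : realType) (f : nat -> R) (l c C : R) n :
  f @ \oo --> l -> (forall T, (n < T)%N -> f T <= c + C / T%:R) -> l <= c.
Proof.
move=> fl fle; have h : (c + C / T.+1%:R) @[T --> \oo] --> c.
  rewrite -[X in _ --> X]addr0 -[X in _ + X](mulr0 C).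
  by apply: cvgD; [exact: cvg_cst | apply: cvgM; [exact: cvg_cst | exact: cvg_harmonic]].
have fl' : f T.+1 @[T --> \oo] --> l by rewrite (cvg_shiftS f).
apply: (ler_cvg_to fl' h); exists n => // T /= nT; exact: fle.
Qed.

Section HomogeneousPart.
Variables (R : realType) (V : lmodType R) (N : V -> R) (x : nat -> V).
Variables (E : normedModType R) (z : nat -> E).
Hypotheses (SN : seminorm N) (OS : one_spreading N x).
Hypothesis xz : forall n a,
  N (lincomb (block_average x m) n a) @[m --> \oo] --> `|lincomb z n a|.

Lemma one_spreading_cond n (f : nat -> nat) (P : pred nat) (a : nat -> R) :
  (forall i, (i.+1 < n)%N -> (f i < f i.+1)%N) ->
  N (\sum_(i < n | P i) a i *: x (f i)) = N (\sum_(i < n | P i) a i *: x i).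
Proof.
move=> fS; pose b i := if P i then a i else 0.
have bE (g : nat -> nat) :
    \sum_(i < n | P i) a i *: x (g i) = \sum_(i < n) b i *: x (g i).
  rewrite big_mkcond/=; apply: eq_bigr => i _; rewrite /b.
  by case: ifP => // _; rewrite scale0r.
by rewrite (bE f) (bE id) (one_spreading_fin OS).
Qed.

(** [f] may fail to be injective, so coefficients with the same image are collected before passing
    to the limit. *)
Lemma cvg_reindexed n (a : nat -> R) (f : nat -> nat) :
  N (\sum_(i < n) a i *: block_average x m (f i)) @[m --> \oo] -->
  `|\sum_(i < n) a i *: z (f i)|.
Proof.
pose K := (\max_(i < n) f i).+1.
have fK i : (i < n)%N -> (f i < K)%N.
  by move=> iN; rewrite ltnS (leq_bigmax (Ordinal iN)).
under eq_fun do rewrite (lincomb_reindex _ _ fK).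
rewrite (lincomb_reindex _ _ fK); exact: xz.
Qed.

Lemma cvg_restricted n (a : nat -> R) (f : nat -> nat) (D : pred nat) :
  N (\sum_(i < n | D i) a i *: block_average x m (f i)) @[m --> \oo] -->
  `|\sum_(i < n | D i) a i *: z (f i)|.
Proof.
pose b i := if D i then a i else 0.
have bE (W : lmodType R) (y : nat -> W) :
    \sum_(i < n | D i) a i *: y (f i) = \sum_(i < n) b i *: y (f i).
  rewrite big_mkcond/=; apply: eq_bigr => i _; rewrite /b.
  by case: ifP => // _; rewrite scale0r.
under eq_fun do rewrite bE.
rewrite bE; exact: cvg_reindexed.
Qed.

(** Every block is collapsed; as the window length T grows, the window averages turn into the
    vectors [z (kappa i)] and the error O(1/T) disappears. *)
Lemma reindex_monotone_le n (a : nat -> R) (kappa : nat -> nat) :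
  {homo kappa : i j / (i <= j)%N} ->
  `|\sum_(i < n) a i *: z (kappa i)| <= N (lincomb x n a).
Proof.
move=> km; apply: (@le_of_cvg_harmonic _ _ _ _ ((\sum_(i < n) `|a i|) * (2 * n%:R * N (x 0))) n
  (@cvg_reindexed n a kappa)) => T nT.
have := collapse SN OS a predT km nT.
by rewrite big_pred0// add0r mulrA.
Qed.

(** Collapsing only the blocks in [D] does not increase the norm in the limit, and the untouched
    blocks differ from the result by window averages whose norm tends to the last term. *)
Lemma suppression n (a : nat -> R) (kappa : nat -> nat) (D : pred nat) :
  {homo kappa : i j / (i <= j)%N} ->
  N (\sum_(i < n | ~~ D (kappa i)) a i *: x i) <=
  N (lincomb x n a) + `|\sum_(i < n | D (kappa i)) a i *: z (kappa i)|.
Proof.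
move=> km; rewrite -lerBlDr; set S := N _; set l := `|_|.
have h := cvgB (cvg_cst S) (@cvg_restricted n a kappa (fun i => D (kappa i))).
apply: (@le_of_cvg_harmonic _ _ _ _ ((\sum_(i < n) `|a i|) * (2 * n%:R * N (x 0))) n (h _ _))
  => T nT /=.
rewrite /S -(@one_spreading_cond n (fun i => kappa i * T + i)%N (fun i => ~~ D (kappa i)));
  last first.
  move=> i _; have := leq_mul2r T (kappa i) (kappa i.+1).
  by rewrite km// orbT; lia.
rewrite -[X in _ <= _ + X]mulrA; apply: le_trans (collapse SN OS a D km nT).
set v := \sum_(i < n | D _) _; set w := \sum_(i < n | ~~ _) _.
by rewrite lerBlDr -{1}(addrK v w) sn_sub.
Qed.

(** A collapsed block contributes [z k] times its coefficient sum, so the extra term of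
    [suppression] vanishes. *)
Lemma zero_sum_suppression n (a : nat -> R) (kappa : nat -> nat) (D : pred nat) :
  {homo kappa : i j / (i <= j)%N} ->
  (forall k, D k -> \sum_(i < n | kappa i == k) a i = 0) ->
  N (\sum_(i < n | ~~ D (kappa i)) a i *: x i) <= N (lincomb x n a).
Proof.
move=> km a0; have := @suppression n a kappa D km.
suff -> : \sum_(i < n | D (kappa i)) a i *: z (kappa i) = 0 by rewrite normr0 addr0.
pose K := (kappa n).+1.
rewrite (partition_big (fun i : 'I_n => inord (kappa i) : 'I_K) xpredT)//=.
apply: big1 => k _.
have kE (i : 'I_n) : (inord (kappa i) == k :> 'I_K) = (kappa i == k :> nat).
  by rewrite -val_eqE/= inordK// ltnS km// ltnW.
rewrite (eq_bigl (fun i : 'I_n => D k && (kappa i == k :> nat))); last first.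
  by move=> i; rewrite kE; case: eqP => [->|]; rewrite ?andbT ?andbF.
have [Dk|nDk] := boolP (D k); last by rewrite big_pred0.
rewrite (eq_bigr (fun i : 'I_n => a i *: z k)) => [|i /andP[_ /eqP ->]//].
by rewrite -scaler_suml a0// scale0r.
Qed.

(** For each window length [m] the norms already agree: the averages at the positions [f i] are the
    averages of [x \o g] at the positions [i], where [g] moves window [i] onto window [f i]. *)
Lemma homogeneous_one_spreading : one_spreading (fun v : E => `|v|) z.
Proof.
move=> f fS n a /=; apply/esym.
have h m : N (\sum_(i < n) a i *: block_average x m (f i)) =
    N (lincomb (block_average x m) n a).
  pose g t := (f (t %/ m) * m + t %% m)%N.
  have gE i : block_average x m (f i) = block_average (x \o g) m i.
    rewrite /block_average; congr (_ *: _).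
    rewrite -{1}[(f i * m)%N]add0n -{1}[(i * m)%N]add0n !big_addn -!mulnBl !subSnn mul1n.
    apply: eq_big_nat => j /andP[_ jm] /=; rewrite /g (addnC j (i * m)%N) divnMDl; last by lia.
    by rewrite divn_small// addn0 modnMDl modn_small// addnC.
  under eq_bigr do rewrite gE.
  rewrite -/(lincomb _ n a) !lincomb_block_average; apply: (one_spreading_fin OS) => t tn.
  have m0 : (0 < m)%N by case: (m) tn => [|//]; rewrite muln0.
  rewrite /g; have := leq_div2r m (leqnSn t); rewrite leq_eqVlt => /orP[/eqP e|].
    by rewrite -e ltn_add2l; move: (divn_eq t m) (divn_eq t.+1 m); rewrite -e; lia.
  move=> /fS; rewrite -(leq_pmul2r m0) mulSn; have := ltn_pmod t m0.
  move: (t %% m)%N (f _ * m)%N (f _ * m)%N => *; lia.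
have h1 := @cvg_reindexed n a f.
apply: (norm_cvg_unique h1) => /=; under eq_fun do rewrite h; exact: xz.
Qed.

(** An average of [m] consecutive window averages of length [p] is a window average of length
    [m * p], so both sides are limits of the same norms. Thus [z] is its own homogeneous part. *)
Lemma norm_lincomb_block_average m n (a : nat -> R) : (0 < m)%N ->
  `|lincomb (block_average z m) n a| = `|lincomb z n a|.
Proof.
move=> m0; rewrite lincomb_block_average.
have h := @xz (n * m)%N (fun t => a (t %/ m)%N / m%:R).
have h1 := cvg_comp _ _ (@cvg_mulnl m m0) (@xz n a).
have e p : N (lincomb (block_average x p) (n * m) (fun t => a (t %/ m)%N / m%:R)) =
    N (lincomb (block_average x (m * p)) n a).
  rewrite !lincomb_block_average mulnA; congr N.
  apply: eq_bigr => i _; congr (_ *: _).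
  by rewrite -divnMA [(p * m)%N]mulnC natrM invfM mulrA.
by apply: (norm_cvg_unique h) => /=; under eq_fun do rewrite e.
Qed.

End HomogeneousPart.

(** Since [z] is 1-spreading and its own homogeneous part, the collapse estimate applies with [z] in
    place of [x]. *)
Lemma homogeneous_reindex_le (R : realType) (V : lmodType R) (N : V -> R)
    (x : nat -> V) (E : normedModType R) (z : nat -> E) :
  seminorm N -> one_spreading N x ->
  (forall n a, N (lincomb (block_average x m) n a) @[m --> \oo] --> `|lincomb z n a|) ->
  forall n (a : nat -> R) (kappa : nat -> nat),
  {homo kappa : i j / (i <= j)%N} ->
  `|\sum_(i < n) a i *: z (kappa i)| <= `|lincomb z n a|.
Proof.
move=> SN OS xz n a kappa km.
apply: (@reindex_monotone_le _ _ (fun v : E => `|v|) z _ z) => //.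
- by split=> [u v|b v]; [exact: ler_normD | exact: normrZ].
- exact: homogeneous_one_spreading OS xz.
- move=> n' a'; apply: cvg_near_cst; exists 1%N => // m /= m0.
  by rewrite (norm_lincomb_block_average xz).
Qed.

Lemma norm_seminorm (R : realType) (E : normedModType R) :
  seminorm (fun v : E => `|v|).
Proof. by split=> [u v|b v]; [exact: ler_normD | exact: normrZ]. Qed.

(** * Increments *)

(** [kappa i] is the least [l] with [i < p l.+1]; in this way the indices before [p 0] join block
    0. *)
Lemma block_index (p : nat -> nat) : strictly_increasing p ->
  exists kappa : nat -> nat, [/\ {homo kappa : i j / (i <= j)%N},
    forall l i, (p l <= i < p l.+1)%N -> kappa i = l &
    forall i, (i < p 0)%N -> kappa i = 0%N].
Proof.
move=> pS; have pm : {homo p : i j / (i <= j)%N}.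
  by apply: homo_leq => [//|? ? ?|i]; [exact: leq_trans | exact/ltnW/pS].
have pS' i : (p i < p i.+1)%N by exact: pS.
have ex i : exists l, (i < p l.+1)%N.
  by exists i; elim: i => [|i IH]; [have := pS' 0%N | have := pS' i.+1]; lia.
exists (fun i => ex_minn (ex i)); split=> [i j ij|l i /andP[li il]|i i0].
- case: ex_minnP => k ik kmin; case: ex_minnP => l jl _; apply: kmin; lia.
- case: ex_minnP => k ik kmin; apply/eqP; rewrite eqn_leq kmin//= leqNgt.
  by apply/negP => kl; have := pm _ _ kl; lia.
- case: ex_minnP => k _ kmin; have := kmin 0%N; have := pS' 0%N; lia.
Qed.

Lemma big_double (V : nmodType) n (P : pred nat) (F : nat -> V) :
  \sum_(t < n.*2 | P t./2) F t = \sum_(l < n | P l) (F l.*2 + F l.*2.+1).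
Proof.
rewrite big_mkcond [RHS]big_mkcond/=; elim: n => [|n IH]; first by rewrite !big_ord0.
rewrite doubleS !big_ord_recr/= IH -addrA; congr (_ + _).
by rewrite uphalf_double half_double; case: ifP; rewrite ?addr0.
Qed.

Section Increments.
Variables (R : realType) (V : lmodType R).

(** Differences over disjoint consecutive pairs: the simplest blocks of coefficient sum zero, which
    makes them unconditional. *)
Definition increments (x : nat -> V) (l : nat) : V := x l.*2.+1 - x l.*2.

Definition increment_coef (a : nat -> R) (t : nat) : R :=
  if odd t then a t./2 else - a t./2.

Lemma sum_increments (x : nat -> V) n (P : pred nat) (a : nat -> R) (f : nat -> nat) :
  \sum_(t < n.*2 | P t./2) increment_coef a t *: x (f t) =
  \sum_(l < n | P l) a l *: (x (f l.*2.+1) - x (f l.*2)).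
Proof.
rewrite (big_double n P (fun t => increment_coef a t *: x (f t))).
apply: eq_bigr => l _; rewrite /increment_coef /= odd_double/= uphalf_double half_double.
by rewrite scaleNr scalerBr addrC.
Qed.

Lemma lincomb_increments (x : nat -> V) n (a : nat -> R) :
  lincomb (increments x) n a = lincomb x n.*2 (increment_coef a).
Proof. by rewrite /lincomb (@sum_increments x n predT a id). Qed.

Variables (N : V -> R) (x : nat -> V).
Hypotheses (SN : seminorm N) (OS : one_spreading N x).

(** Pairs placed one after the other are a spread copy of the pairs 2l, 2l + 1. *)
Lemma increments_spread n (a : nat -> R) (f g : nat -> nat) :
  (forall l, (l < n)%N -> (f l < g l)%N) ->
  (forall l, (l.+1 < n)%N -> (g l < f l.+1)%N) ->
  N (\sum_(l < n) a l *: (x (g l) - x (f l))) = N (lincomb (increments x) n a).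
Proof.
move=> fg gf; pose h t := if odd t then g t./2 else f t./2.
have := @sum_increments x n predT a h; rewrite /h/=.
under [X in _ = X -> _]eq_bigr do rewrite odd_double /= uphalf_double half_double.
move=> <-; rewrite lincomb_increments.
rewrite (one_spreading_fin OS (n := n.*2) (f := h) (increment_coef a)) // => t.
rewrite /h /= uphalf_half; have := odd_double_half t.
by case: (odd t) => /= tE tn; [rewrite add1n; apply: gf | rewrite add0n; apply: fg]; lia.
Qed.

Lemma increments_one_spreading : one_spreading N (increments x).
Proof.
move=> f fS n a; rewrite -(@increments_spread n a (fun l => (f l).*2) (fun l => (f
  l).*2.+1))//.
by move=> l _; have := fS _ _ (ltnSn l); lia.
Qed.

Lemma increments_le n (a : nat -> R) :
  N (lincomb (increments x) n a) <= 2 * N (lincomb x n a).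
Proof.
rewrite /lincomb; under eq_bigr do rewrite scalerBr.
rewrite sumrB mulr2n mulrDl mul1r; apply: (le_trans (sn_sub SN _ _)).
by rewrite !(one_spreading_fin OS (f := fun l => l.*2))
  ?(one_spreading_fin OS (f := fun l => l.*2.+1))//; lia.
Qed.

Variables (E : normedModType R) (z : nat -> E).
Hypothesis xz : forall n a,
  N (lincomb (block_average x m) n a) @[m --> \oo] --> `|lincomb z n a|.

Lemma increments_suppression n (a : nat -> R) (D : pred nat) :
  N (\sum_(l < n | D l) a l *: increments x l) <= N (lincomb (increments x) n a).
Proof.
rewrite lincomb_increments -(@sum_increments x n D a id).
rewrite (eq_bigl (fun t : 'I_n.*2 => ~~ predC D t./2)); last by move=> t /=; rewrite negbK.
apply: (@zero_sum_suppression _ _ N x E z SN OS xz n.*2 (increment_coef a) half (predC D)).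
  by move=> i j; exact: half_leq.
move=> k _; rewrite (big_double n (eq_op^~ k)) big1// => l _.
by rewrite /increment_coef /= odd_double/= uphalf_double half_double addNr.
Qed.

(* Compare the last vector of each window of length m with the window average. *)
Lemma le_increments_homogeneous n (a : nat -> R) :
  N (lincomb x n a) <= N (lincomb (increments x) n a) + `|lincomb z n a|.
Proof.
rewrite -lerBlDl; apply: (ler_cvg_to (cvg_cst _) (@xz n a)).
exists 1%N => // m /= m0; rewrite lerBlDl.
rewrite -(@one_spreading_fin _ _ _ _ OS n (fun i => i * m + m.-1)%N); last by move=> i _; lia.
set v := (X in N X <= _).
rewrite addrC; apply: (le_trans (sn_dist SN v (lincomb (block_average x m) n a))).
rewrite lerD2l.
have -> : v - lincomb (block_average x m) n a = m%:R^-1 *: \sum_(j < m)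
   \sum_(i < n) a i *: (x (i * m + m.-1)%N - x (i * m + j)%N).
  rewrite exchange_big/= scaler_sumr /v /lincomb -sumrB; apply: eq_bigr => i _.
  rewrite -scalerBr -scaler_sumr scalerA mulrC -scalerA; congr (_ *: _).
  rewrite sumrB sumr_const card_ord scalerBr -[x _ *+ m]scaler_nat scalerA mulVf ?pnatr_eq0
    -?lt0n//.
  rewrite scale1r /block_average; congr (_ - _ *: _).
  rewrite -{1}[(i * m)%N]add0n big_addn -mulnBl subSnn mul1n big_mkord.
  by apply: eq_bigr => j _; rewrite addnC.
apply: (sn_average SN (y := fun j => \sum_(i < n) a i *: (x (i * m + m.-1)%N - x (i * m +
  j)%N))) => // j jm.
have [->|jm1] := eqVneq j m.-1.
  by rewrite big1 ?(sn0 SN) ?(sn_ge0 SN)// => i _; rewrite subrr scaler0.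
rewrite (@increments_spread n a (fun i => i * m + j)%N (fun i => i * m + m.-1)%N)//; lia.
Qed.
End Increments.

Lemma sum_half_le2 (R : realType) n : \sum_(k < n) (2^-1 : R) ^+ k <= 2.
Proof.
suff -> : \sum_(k < n) (2^-1 : R) ^+ k = 2 - 2 * 2^-1 ^+ n.
  by rewrite gerBl mulr_ge0// exprn_ge0// invr_ge0.
elim: n => [|n IH]; first by rewrite big_ord0 expr0 mulr1 subrr.
by rewrite big_ord_recr/= IH exprS; lra.
Qed.

(** * Convex blocks dominated by the homogeneous part *)

Section ConvexBlocks.
Variables (R : realType) (V : lmodType R) (N : V -> R) (x : nat -> V).
Variables (E : normedModType R) (z : nat -> E).
Hypotheses (SN : seminorm N) (OS : one_spreading N x).
Hypothesis xz : forall n a,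
  N (lincomb (block_average x m) n a) @[m --> \oo] --> `|lincomb z n a|.
Hypothesis not_l1 : forall d : R, 0 < d -> exists n (a : nat -> R),
  \sum_(i < n) `|a i| = 1 /\ N (lincomb x n a) <= d.

(** Passing to increments costs a factor 2; they are unconditional, and taking absolute values of
    the coefficients costs another 2. Hence [d / 4]. *)
Lemma small_convex_increments d : 0 < d -> exists n (a : nat -> R),
  [/\ forall i, 0 <= a i, \sum_(i < n) a i = 1 &
      N (lincomb (increments x) n a) <= d].
Proof.
move=> d0; have [|n [a [a1 ad]]] := not_l1 (d := d / 4); first by rewrite divr_gt0.
exists n, (fun i => `|a i|); split=> //.
have := sn_abs_multipliers SN (@increments_suppression _ _ N x SN OS E z xz n a).
move/le_trans; apply; have := increments_le SN OS n a.
by rewrite -/(lincomb _ n a); lra.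
Qed.

(** [le_increments_homogeneous] splits the norm of a block combination into an increment part and
    its counterpart in Z. Blocks whose increments have norm at most 2^-k make the first part at most
    2C |sum a_k z_k|, because coordinates on Z are bounded by C; convexity bounds the second by |sum
    a_k z_k|. *)
Lemma convex_blocks_dominated C :
  (forall n (a : nat -> R) k, (k < n)%N -> `|a k| <= C * `|lincomb z n a|) ->
  exists (q : nat -> nat) (c : nat -> R), [/\ strictly_increasing q, q 0 = 0%N,
    forall i, 0 <= c i, forall k, \sum_(q k <= i < q k.+1) c i = 1 &
    forall n (a : nat -> R),
      N (\sum_(k < n) a k *: \sum_(q k <= i < q k.+1) c i *: x i) <=
      (2 * C + 1) * `|lincomb z n a|].
Proof.
move=> zC; have /choice[md Hmd] : forall k, exists md : nat * (nat -> R),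
    [/\ forall i, 0 <= md.2 i, \sum_(i < md.1) md.2 i = 1 &
        N (lincomb (increments x) md.1 md.2) <= 2^-1 ^+ k].
  move=> k; have [|n [a [a0 a1 au]]] := @small_convex_increments (2^-1 ^+ k).
    by rewrite exprn_gt0 // invr_gt0.
  by exists (n, a).
pose m k := (md k).1; pose d k := (md k).2.
have m0 k : (0 < m k)%N.
  rewrite lt0n; apply/negP => /eqP mk; have [_ + _] := Hmd k.
  by rewrite -/(m k) mk big_ord0 => /eqP; rewrite eq_sym oner_eq0.
pose q k := (\sum_(j < k) m j)%N.
have qS k : q k.+1 = (q k + m k)%N by rewrite /q big_ord_recr.
have qs : strictly_increasing q.
  by apply: homo_ltn => [? ? ?|k]; [exact: ltn_trans | rewrite qS -{1}[q k]addn0 ltn_add2l].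
have qm : {homo q : i j / (i <= j)%N}.
  by apply: homo_leq => [//|? ? ?|k]; [exact: leq_trans | exact/ltnW/qs].
have [kappa [_ kq _]] := block_index qs.
pose c i := d (kappa i) (i - q (kappa i))%N.
have kE k j : (j < m k)%N -> kappa (q k + j)%N = k.
  by move=> jm; apply: kq; rewrite qS leq_addr ltn_add2l.
have blk (W : nmodType) (F : nat -> W) k :
    \sum_(q k <= i < q k.+1) F i = \sum_(j < m k) F (q k + j)%N.
  rewrite -{1}[q k]add0n big_addn qS addKn big_mkord.
  by apply: eq_bigr => j _; rewrite addnC.
have cE k j : (j < m k)%N -> c (q k + j)%N = d k j by move=> jm; rewrite /c kE// addKn.
have q0 : q 0%N = 0%N by rewrite /q big_ord0.
pose f (a : nat -> R) i := a (kappa i) * c i.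
have fE (W : lmodType R) (y : nat -> W) n (a : nat -> R) : lincomb y (q n) (f a) =
    \sum_(k < n) a k *: \sum_(j < m k) d k j *: y (q k + j)%N.
  rewrite lincomb_nat -{1}q0 big_blocks//; apply: eq_bigr => k _.
  rewrite blk scaler_sumr; apply: eq_bigr => j _.
  by rewrite /f kE// cE// scalerA.
exists q, c; split=> // [i|k|n a].
- by rewrite /c; have [+ _ _] := Hmd (kappa i); apply.
- by rewrite blk; have [_ <- _] := Hmd k; apply: eq_bigr => j _; rewrite cE.
have -> : \sum_(k < n) a k *: (\sum_(q k <= i < q k.+1) c i *: x i) =
    lincomb x (q n) (f a).
  rewrite fE; apply: eq_bigr => k _; rewrite blk; congr (_ *: _).
  by apply: eq_bigr => j _; rewrite cE.
apply: (le_trans (le_increments_homogeneous SN OS xz _ _)); rewrite mulrDl mul1r.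
apply: lerD; rewrite fE.
- apply: (le_trans (sn_sum SN _ _ _)).
  apply: (@le_trans _ _ (\sum_(k < n) C * `|lincomb z n a| * 2^-1 ^+ k)).
    apply: ler_sum => k _; rewrite (sn_scale SN) ler_pM ?(sn_ge0 SN)//; first exact: zC.
    rewrite (one_spreading_fin (increments_one_spreading OS) (f := fun j => (q k + j)%N)).
      by have [] := Hmd k.
    by move=> i _; rewrite ltn_add2l.
  rewrite -mulr_sumr mulrC -mulrA; apply: ler_wpM2r; last exact: sum_half_le2.
  case: n => [|n] in a *; first by rewrite /lincomb big_ord0 normr0 mulr0.
  by apply: le_trans (zC n.+1 a 0%N isT).
(* One index from each block gives a spread subsequence of [z]; the convex weights average over
   these choices. *)
have OSz := homogeneous_one_spreading OS xz.
have -> : \sum_(k < n) a k *: (\sum_(j < m k) d k j *: z (q k + j)) =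
    0 + \sum_(k < n) \sum_(j < m k) d k j *: (a k *: z (q k + j)).
  rewrite add0r; apply: eq_bigr => k _; rewrite scaler_sumr; apply: eq_bigr => j _.
  by rewrite !scalerA mulrC.
apply: (sn_convex_blocks (norm_seminorm E) (y := fun k j => a k *: z (q k + j)%N)).
- by move=> k j; have [+ _ _] := Hmd k; apply.
- by move=> k; have [] := Hmd k.
move=> g gm; rewrite add0r (one_spreading_fin OSz (f := fun k => (q k + g k)%N))// => i _.
by rewrite qS; have := gm i; lia.
Qed.
End ConvexBlocks.

(** * Conditional spreading bases *)

(** Place the j-th vector at position 2j. Moving only the i-th one to 2i + 1 keeps the norm, and the
    two placements differ by [a i] times an increment. *)
Lemma coordinate_le (R : realType) (V : lmodType R) (N : V -> R) (x : nat -> V) :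
  seminorm N -> one_spreading N x ->
  forall n (a : nat -> R) i, (i < n)%N ->
  `|a i| * N (increments x 0) <= 2 * N (lincomb x n a).
Proof.
move=> SN OS n a i ni.
rewrite -(one_spreading_term (increments_one_spreading OS) i) -(sn_scale SN).
pose f b j := (j.*2 + (b && (j == i)))%N.
have -> : a i *: increments x i =
    \sum_(j < n) a j *: x (f true j) - \sum_(j < n) a j *: x (f false j).
  rewrite -sumrB (bigD1 (Ordinal ni))//= /f eqxx/= big1 ?addr0.
    by rewrite addn1 addn0 scalerBr.
  by move=> j; rewrite -val_eqE/= => /negbTE ->; rewrite subrr.
apply: (le_trans (sn_sub SN _ _)); rewrite mulr2n mulrDl mul1r.
by apply: lerD; rewrite (one_spreading_fin OS) // => j _; rewrite /f; case: eqP; case: eqP;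
  lia.
Qed.

(** * A criterion for unconditionality *)

Section UnconditionalBasis.
Variables (R : realType) (X : completeNormedModType R) (e : nat -> X).
Hypothesis eB : schauder_basis e.

(** A late piece of a rearranged series is the restriction of a late piece of the original series to
    a set of indices, hence small by hypothesis; the rearranged series is Cauchy. *)
Lemma suppression_unconditional (C : R) :
  (forall n (a : nat -> R) (D : pred nat),
     `|\sum_(i < n | D i) a i *: e i| <= C * `|lincomb e n a|) ->
  unconditional_basis e.
Proof.
move=> supp; split=> // a x ax s [g sg gs]; apply: cauchy_cvg; apply/cauchy_seriesP => d d0.
have := ax; rewrite /expansion => /cvgrPdist_lt ax'.
pose d' := d / (2 * (`|C| + 1)).
have C0 : 0 < `|C| + 1 by rewrite ltr_wpDl.
have d'0 : 0 < d' by rewrite divr_gt0// mulr_gt0.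
have [n0 _ Hn0] := ax' _ d'0.
(* From [m0] on, the rearrangement has used up all indices below [n0]. *)
pose m0 := (\max_(j < n0) g j).+1.
have sm0 i : (m0 <= i)%N -> (n0 <= s i)%N.
  move=> mi; rewrite leqNgt; apply/negP => sin0.
  have : (g (s i) <= \max_(j < n0) g j)%N by exact: (leq_bigmax (Ordinal sin0)).
  by rewrite sg leqNgt mi.
exists ([set k | (m0 <= k)%N], [set k | (m0 <= k)%N]) => /=.
  by split; exists m0.
move=> [p q] /= [mp mq].
pose n := maxn n0 (\max_(i < q) (s i)).+1.
(* The cut changes nothing on the selected indices and turns the full sum into a difference of
   partial sums. *)
pose b j := if (n0 <= j)%N then a j else 0.
pose D j := (p <= g j < q)%N.
have -> : \sum_(p <= k < q) a (s k) *: e (s k) = \sum_(j < n | D j) b j *: e j.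
  transitivity (\sum_(p <= k < q) b (s k) *: e (s k)).
    apply: eq_big_nat => k /andP[pk _]; rewrite /b sm0//; exact: leq_trans pk.
  rewrite -(big_map s xpredT (fun j => b j *: e j)).
  rewrite -(big_mkord D (fun j => b j *: e j)) -[RHS]big_filter.
  apply: perm_big; apply: uniq_perm.
  - by rewrite map_inj_uniq ?iota_uniq//; exact: can_inj sg.
  - by rewrite filter_uniq// iota_uniq.
  move=> j; rewrite mem_filter mem_index_iota /= -{1}[j]gs mem_map; last exact: can_inj sg.
  rewrite mem_index_iota /D; case: andP => //= -[_ gq].
  apply/esym; rewrite /n leq_max; apply/orP; right; rewrite ltnS.
  by rewrite -{1}[j]gs; exact: (leq_bigmax (Ordinal gq)).
apply: (le_lt_trans (supp _ _ _)).
have -> : lincomb e n b = lincomb e n a - lincomb e n0 a.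
  rewrite !lincomb_nat (big_cat_nat _ (n := n0) (p := n)) ?leq_maxl//=.
  rewrite [in RHS](big_cat_nat _ (n := n0) (p := n)) ?leq_maxl//= addrAC subrr add0r.
  rewrite big_nat big1 ?add0r => [|i /andP[_ i0]]; last by rewrite /b leqNgt i0 scale0r.
  by apply: eq_big_nat => i /andP[i0 _]; rewrite /b i0.
have h k : (n0 <= k)%N -> `|lincomb e k a - x| < d'.
  by move=> /Hn0 /=; rewrite distrC /series /= lincomb_nat.
apply: (@le_lt_trans _ _ (`|C| * `|lincomb e n a - lincomb e n0 a|)).
  by rewrite ler_wpM2r// ler_norm.
have : `|lincomb e n a - lincomb e n0 a| < 2 * d'.
  rewrite -(subrKA x) (le_lt_trans (ler_normD _ _))// mulr2n mulrDl mul1r.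
  by rewrite ltrD ?h ?leq_maxl// distrC h.
move=> hd; apply: (@le_lt_trans _ _ (`|C| * (2 * d'))); first by rewrite ler_wpM2l// ltW.
rewrite (_ : d = (`|C| + 1) * (2 * d')); last by rewrite /d'; field; rewrite gt_eqF.
by rewrite ltr_pM2r ?mulr_gt0// ltrDl.
Qed.

End UnconditionalBasis.

(** The interface between the renormed space and the rest of the argument, in the given norm of X
    and with one constant. [coef] gives the coordinate functionals, [hb_reindex] the collapsing
    estimate, [hb_zero_sum] the unconditionality of zero-sum blocks, [hb_tail] the domination of the
    summing basis by [z]. *)
Record homogeneous_basis (R : realType) (X E : normedModType R) (e : nat -> X)
    (z : nat -> E) (coef : X -> nat -> R) (C : R) : Prop := HomogeneousBasis {
  hb_gt0 : 0 < C;
  hb_norm : forall i, `|e i| <= C;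
  hb_linear : forall (a : R) x y i,
    coef (a *: x + y) i = a * coef x i + coef y i;
  hb_coef : forall n (a : nat -> R) i,
    coef (lincomb e n a) i = if (i < n)%N then a i else 0;
  hb_cvg : forall x, lincomb e m (coef x) @[m --> \oo] --> x;
  hb_bounded : forall m x, `|lincomb e m (coef x)| <= C * `|x|;
  hb_sum : forall n (a : nat -> R), `|\sum_(i < n) a i| <= C * `|lincomb e n a|;
  hb_reindex : forall n (a : nat -> R) kappa, {homo kappa : i j / (i <= j)%N} ->
    `|\sum_(i < n) a i *: z (kappa i)| <= C * `|lincomb e n a|;
  hb_zero_sum : forall n (a : nat -> R) kappa (D : pred nat),
    {homo kappa : i j / (i <= j)%N} ->
    (forall k, D k -> \sum_(i < n | kappa i == k) a i = 0) ->
    `|\sum_(i < n | ~~ D (kappa i)) a i *: e i| <= C * `|lincomb e n a|;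
  hb_tail : forall n (a : nat -> R) j,
    `|\sum_(i < n | (j <= i)%N) a i| <= C * `|lincomb z n a|;
  hb_not_l1 : forall d : R, 0 < d -> exists n (a : nat -> R),
    \sum_(i < n) `|a i| = 1 /\ `|lincomb z n a| <= d;
  hb_spreading : one_spreading (fun v : E => `|v|) z;
  hb_z_reindex : forall n (a : nat -> R) kappa, {homo kappa : i j / (i <= j)%N} ->
    `|\sum_(i < n) a i *: z (kappa i)| <= `|lincomb z n a|;
  hb_blocks : exists (q : nat -> nat) (c : nat -> R),
    [/\ strictly_increasing q, q 0 = 0%N,
        forall k, \sum_(q k <= i < q k.+1) c i = 1 &
        forall n (a : nat -> R),
          `|\sum_(k < n) a k *: \sum_(q k <= i < q k.+1) c i *: e i| <=
          C * `|lincomb z n a|] }.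

(** * Consequences of conditionality and of the 1-spreading norm *)

Section HomogeneousBasis.
Variables (R : realType) (X : completeNormedModType R) (e : nat -> X).
Variables (N : X -> R) (E : normedModType R) (z : nat -> E).
Hypotheses (eB : schauder_basis e) (eC : ~ unconditional_basis e).
Hypotheses (EN : equivalent_norm N) (OS : one_spreading N e).
Hypothesis xz : forall n a,
  N (lincomb (block_average e m) n a) @[m --> \oo] --> `|lincomb z n a|.

Let SN : seminorm N. Proof. by case: EN. Qed.

Lemma expansion_lincomb n (a : nat -> R) :
  expansion e (fun i => if (i < n)%N then a i else 0) (lincomb e n a).
Proof.
apply: cvg_near_cst; exists n => // m /= nm.
rewrite /series/= (big_cat_nat _ (n := n))//= [X in _ + X]big_nat [X in _ + X]big1 ?addr0.
  by rewrite lincomb_nat; apply: eq_big_nat => i /andP[_ ->].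
by move=> i /andP[ni _]; rewrite ltnNge ni/= scale0r.
Qed.

(** If the first two basis vectors coincided, 0 would have two expansions. *)
Lemma increments_gt0 : 0 < N (increments e 0).
Proof.
have [_ _ [c [C [c0 C0 cC]]]] := EN.
apply: lt_le_trans (cC _).1; rewrite mulr_gt0// normr_gt0 /increments.
apply/negP => /eqP e01.
have := @expansion_lincomb 2%N (fun i => if i == 0%N then -1 else 1).
have -> : lincomb e 2 (fun i => if i == 0%N then -1 else 1 : R) = 0.
  by rewrite /lincomb !big_ord_recl big_ord0/= scaleN1r scale1r addr0 addrC.
have := @expansion_lincomb 0%N (fun=> 0); rewrite /lincomb big_ord0.
have [a [_ au]] := eB 0.
move=> /au a0 /au; rewrite a0 => /(congr1 (fun f => f 1%N)) /eqP.
by rewrite /= eq_sym oner_eq0.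
Qed.

(** Coordinates are bounded by [coordinate_le], so every partial sum operator is bounded; these
    operators converge pointwise, and Banach-Steinhaus yields the basis constant [K]. *)
Lemma coef_exists : exists (coef : X -> nat -> R) (K : R),
  [/\ forall (a : R) x y i, coef (a *: x + y) i = a * coef x i + coef y i,
      forall n (a : nat -> R) i, coef (lincomb e n a) i = if (i < n)%N then a i else 0,
      forall x, lincomb e m (coef x) @[m --> \oo] --> x &
      0 < K /\ forall m x, `|lincomb e m (coef x)| <= K * `|x|].
Proof.
have [_ _ [c [C [c0 C0 cC]]]] := EN.
have /choice[coef Hcoef] : forall x, exists a, expansion e a x.
  by move=> x; have [a [ax _]] := eB x; exists a.
have uniq a x : expansion e a x -> coef x = a.
  by have [b [_ bu]] := eB x => /bu <-; apply/esym/bu.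
have cv x : lincomb e m (coef x) @[m --> \oo] --> x.
  by have := Hcoef x; rewrite /expansion /series/=; under eq_fun do rewrite -lincomb_nat.
have lin (a : R) x y i : coef (a *: x + y) i = a * coef x i + coef y i.
  suff /uniq -> : expansion e (fun i => a * coef x i + coef y i) (a *: x + y) by [].
  rewrite /expansion /series/=.
  under eq_fun do (under eq_bigr do rewrite scalerDl -scalerA;
    rewrite big_split -scaler_sumr/=).
  by apply: cvgD; [apply: cvgZr|]; exact: Hcoef.
have linP m (a : R) x y : lincomb e m (coef (a *: x + y)) =
    a *: lincomb e m (coef x) + lincomb e m (coef y).
  rewrite /lincomb; under eq_bigr do rewrite lin scalerDl -scalerA.
  by rewrite big_split -scaler_sumr.
have coefB i : exists B : R, forall x, `|coef x i| <= B * `|x|.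
  pose D := N (increments e 0); have D0 : 0 < D := increments_gt0.
  exists (2 * C / D) => x; rewrite -[leRHS]mulrAC ler_pdivlMr//.
  have h : 2 * C * `|lincomb e m (coef x)| @[m --> \oo] --> 2 * C * `|x|.
    by apply: cvgM; [exact: cvg_cst | apply: cvg_norm].
  apply: (ler_cvg_to (cvg_cst _) h); exists i.+1 => // m /= im.
  apply: (le_trans (coordinate_le SN OS _ im)).
  by rewrite -mulrA ler_wpM2l// (cC _).2.
pose F := [set f | exists m, f = (fun x => lincomb e m (coef x))].
have FB f : F f -> bounded_fun_norm f /\ linear f.
  move=> [m ->]; split; last by move=> a x y; exact: linP.
  move=> r; have /choice[B HB] := coefB.
  exists (\sum_(i < m) (`|B i| * `|r|) * `|e i|) => x xr.
  apply: (le_trans (ler_norm_sum _ _ _)); apply: ler_sum => i _.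
  rewrite normrZ ler_wpM2r//; apply: (le_trans (HB i x)).
  apply: (@le_trans _ _ (`|B i| * `|x|)); first by rewrite ler_wpM2r// ler_norm.
  by rewrite ler_wpM2l// (le_trans xr)// ler_norm.
have FP : pointwise_bounded F.
  move=> x; have := cvg_seq_bounded (cvgP _ (cv x)).
  move=> [M [_ HM]]; exists (M + 1) => _ [m ->].
  by apply: (HM (M + 1)); rewrite // ltrDl.
have [M HM] := Banach_Steinhauss FB FP 1.
exists coef, (`|M| + 1); split=> //.
  by move=> n a i; rewrite (uniq _ _ (@expansion_lincomb n a)).
split; first by rewrite ltr_wpDl.
move=> m x; have [->|x0] := eqVneq x 0.
  have := linP m 0 0 0; rewrite !scale0r addr0 => ->.
  by rewrite add0r normr0 mulr0; have := linP m (-1) 0 0;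
    rewrite scaler0 addr0 scaleN1r addNr => ->; rewrite normr0.
have nx : 0 < `|x| by rewrite normr_gt0.
have xE : x = `|x| *: (`|x|^-1 *: x) + 0.
  by rewrite addr0 scalerA mulfV ?scale1r// gt_eqF.
have P0 : lincomb e m (coef 0) = 0.
  by have := linP m (-1) 0 0; rewrite scaler0 addr0 scaleN1r addNr.
rewrite {1}xE linP P0 addr0 normrZ normr_id mulrC ler_wpM2r//.
apply: (le_trans (HM (fun x => lincomb e m (coef x)) (ex_intro _ m erefl) _ _)).
  by rewrite normrZ normfV normr_id mulVf// gt_eqF.
by rewrite (le_trans (ler_norm M))// lerDl.
Qed.

(** If [z 0 = 0], every [z i] vanishes by spreading, the extra term of [suppression] disappears for
    every set of indices, and the basis is unconditional. *)
Lemma homogeneous_neq0 : 0 < `|z 0|.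
Proof.
rewrite normr_gt0; apply/negP => /eqP z0; apply: eC.
have [_ _ [c [C [c0 C0 cC]]]] := EN.
apply: (@suppression_unconditional _ _ _ eB (C / c)) => n a D.
have OSz := homogeneous_one_spreading OS xz.
have zi i : z i = 0.
  by apply/normr0_eq0; rewrite (one_spreading_term OSz) z0 normr0.
have := @suppression _ _ N e E z SN OS xz n a id (predC D) (fun _ _ h => h).
rewrite [X in _ + `|X|]big1 ?normr0 ?addr0 => [|i _]; last by rewrite zi scaler0.
rewrite (eq_bigl (fun i : 'I_n => D i)) => [h|i]; last by rewrite /= negbK.
rewrite mulrAC ler_pdivlMr// mulrC (le_trans (cC _).1)// (le_trans h)// (cC _).2//.
Qed.

(** Otherwise [N] dominates a multiple of the l_1 norm of the coefficients, which bounds every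
    restriction to a set of indices, and the basis is unconditional. *)
Lemma basis_not_l1 d : 0 < d -> exists n (a : nat -> R),
  \sum_(i < n) `|a i| = 1 /\ N (lincomb e n a) <= d.
Proof.
move=> d0; apply: contrapT => H; apply: eC.
have [_ _ [c [C [c0 C0 cC]]]] := EN.
have dN n (a : nat -> R) : d * \sum_(i < n) `|a i| <= N (lincomb e n a).
  have [->|s0] := eqVneq (\sum_(i < n) `|a i|) 0; first by rewrite mulr0 (sn_ge0 SN).
  have sgt0 : 0 < \sum_(i < n) `|a i| by rewrite lt_neqAle eq_sym s0 sumr_ge0.
  rewrite leNgt; apply/negP => lt; apply: H.
  exists n, (fun i => (\sum_(i < n) `|a i|)^-1 * a i); split.
    under eq_bigr do rewrite normrM gtr0_norm ?invr_gt0//.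
    by rewrite -mulr_sumr mulVf.
  rewrite /lincomb; under eq_bigr do rewrite -scalerA.
  rewrite -scaler_sumr (sn_scale SN) gtr0_norm ?invr_gt0//.
  by rewrite mulrC ler_pdivrMr// ltW.
apply: (@suppression_unconditional _ _ _ eB (N (e 0) * C / (c * d))) => n a D.
have h1 : N (\sum_(i < n | D i) a i *: e i) <= (\sum_(i < n) `|a i|) * N (e 0).
  apply: (le_trans (sn_sum SN _ _ _)).
  rewrite mulr_suml [leRHS](bigID (fun i : 'I_n => D i))/= -[leLHS]addr0; apply: lerD.
    by apply: ler_sum => i _; rewrite (sn_scale SN) (one_spreading_term OS).
  by apply: sumr_ge0 => i _; rewrite mulr_ge0// (sn_ge0 SN).
rewrite mulrAC ler_pdivlMr ?mulr_gt0//.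
have h2 := (cC (\sum_(i < n | D i) a i *: e i)).1.
have h3 := dN n a; have h4 := (cC (lincomb e n a)).2.
apply: (@le_trans _ _ (N (\sum_(i < n | D i) a i *: e i) * d)).
  by rewrite mulrA ler_wpM2r ?(ltW d0)// mulrC.
apply: (@le_trans _ _ (N (e 0) * (d * \sum_(i < n) `|a i|))).
  rewrite [leRHS]mulrCA [leRHS]mulrC; apply: ler_wpM2r; first exact: ltW.
  by rewrite mulrC.
by rewrite -mulrA; apply: ler_wpM2l; [exact: (sn_ge0 SN) | exact: le_trans h4].
Qed.

(** Collapse all indices to 0. *)
Lemma basis_sum n (a : nat -> R) : `|\sum_(i < n) a i| * `|z 0| <= N (lincomb e n a).
Proof.
have := @reindex_monotone_le _ _ N e E z SN OS xz n a (fun=> 0%N) (fun _ _ _ => isT).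
by rewrite -scaler_suml normrZ.
Qed.

(** Removing an initial segment is an operator of norm at most 1 + K, after which [basis_sum]
    applies; [c] and [C] account for the change between the two norms. *)
Lemma basis_tail : exists2 D : R, 0 < D & forall n (a : nat -> R) j,
  `|\sum_(i < n | (j <= i)%N) a i| <= D * N (lincomb e n a).
Proof.
have [coef [K [_ cl _ [K0 cK]]]] := coef_exists.
have [_ _ [c [C [c0 C0 cC]]]] := EN; have z0 := homogeneous_neq0.
exists (C * (1 + K) / (c * `|z 0|)) => [|n a j].
  by rewrite divr_gt0// mulr_gt0// addr_gt0.
have [jn|nj] := leqP j n; last first.
  rewrite big_pred0 => [|i];
    first by rewrite normr0 mulr_ge0 ?(sn_ge0 SN)// divr_ge0 ?mulr_ge0 ?addr_ge0 ?ltW.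
  by apply/negbTE; rewrite -ltnNge (ltn_trans (ltn_ord i)).
pose b i := if (j <= i)%N then a i else 0.
have -> : \sum_(i < n | (j <= i)%N) a i = \sum_(i < n) b i by rewrite big_mkcond.
have bE : lincomb e n b = lincomb e n a - lincomb e j (coef (lincomb e n a)).
  have -> : lincomb e j (coef (lincomb e n a)) = lincomb e j a.
    by apply: eq_bigr => i _; rewrite cl (leq_trans (ltn_ord i) jn).
  rewrite !lincomb_nat (big_cat_nat _ (n := j) (p := n))//= [in RHS](big_cat_nat _ (n := j) (p
    := n))//=.
  rewrite [X in X + _ = _]big_nat [X in X + _ = _]big1 ?add0r => [|i /andP[_ ij]]; last first.
    by rewrite /b leqNgt ij scale0r.
  rewrite addrAC subrr add0r.
  by apply: eq_big_nat => i /andP[ji _]; rewrite /b ji.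
rewrite mulrAC ler_pdivlMr ?mulr_gt0// mulrCA mulrC.
apply: (@le_trans _ _ (N (lincomb e n b) * c)); first by apply: ler_wpM2r;
  [exact: ltW | exact: basis_sum].
apply: (@le_trans _ _ (C * ((1 + K) * `|lincomb e n a|) * c)).
  apply: ler_wpM2r; first exact: ltW.
  apply: (le_trans (cC _).2); apply: ler_wpM2l; first exact: ltW.
  by rewrite bE (le_trans (ler_normB _ _))// mulrDl mul1r lerD2l cK.
rewrite -!mulrA; apply: ler_wpM2l; first exact: ltW.
apply: ler_wpM2l; first by rewrite addr_ge0// ltW.
by rewrite mulrC (cC _).1.
Qed.

(** The tail of [a] from [j] on is the tail, from [j * m] on, of the coefficients of the window
    averages; the estimate for [e] passes to the limit in [m]. *)
Lemma homogeneous_tail : exists2 D : R, 0 < D & forall n (a : nat -> R) j,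
  `|\sum_(i < n | (j <= i)%N) a i| <= D * `|lincomb z n a|.
Proof.
have [D D0 HD] := basis_tail; exists D => // n a j.
have h : D * N (lincomb (block_average e m) n a) @[m --> \oo] --> D * `|lincomb z n a|.
  by apply: cvgM; [exact: cvg_cst | exact: xz].
apply: (ler_cvg_to (cvg_cst _) h); exists 1%N => // m /= m0.
rewrite lincomb_block_average; apply: le_trans (HD _ _ (j * m)%N).
(* Pairing with this indicator sequence turns both tails into combinations in [R^o], so that their
   equality is an instance of [lincomb_block_average]. *)
pose x : nat -> R^o := fun t => (j * m <= t)%:R.
have := @lincomb_block_average R R^o x m n a.
have -> : lincomb (block_average x m) n a = \sum_(i < n | (j <= i)%N) a i.
  rewrite [RHS]big_mkcond; apply: eq_bigr => i _.
  rewrite /block_average (eq_big_nat _ _ (F2 := fun=> (j <= i)%:R)); last first.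
    move=> t /andP[it ti]; rewrite /x; congr ((nat_of_bool _)%:R).
    by apply/idP/idP => h';
      [rewrite -ltnS -(ltn_pmul2r m0) (leq_ltn_trans h') | rewrite (leq_trans _ it)//
        leq_mul2r h' orbT].
  rewrite sumr_const_nat -mulnBl subSnn mul1n -[(j <= i)%:R *+ m]mulr_natl /GRing.scale/=.
  by rewrite mulKf ?pnatr_eq0 -?lt0n//; case: leqP; rewrite ?mulr1 ?mulr0.
have -> : lincomb x (n * m) (fun t => a (t %/ m)%N / m%:R) =
    \sum_(t < n * m | (j * m <= t)%N) a (t %/ m)%N / m%:R.
  rewrite [RHS]big_mkcond; apply: eq_bigr => t _; rewrite /x.
  by rewrite /GRing.scale/=; case: leqP; rewrite ?mulr1 ?mulr0.
by move=> ->.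
Qed.

End HomogeneousBasis.

Lemma tail_sum_rec (R : nmodType) n (a : nat -> R) k : (k < n)%N ->
  \sum_(i < n | (k <= i)%N) a i = a k + \sum_(i < n | (k < i)%N) a i.
Proof.
move=> kn; rewrite (bigD1 (Ordinal kn))//=; congr (_ + _); apply: eq_bigl => i.
by rewrite -val_eqE/= ltn_neqAle eq_sym andbC.
Qed.

Lemma homogeneous_basis_exists (R : realType) (X : completeNormedModType R)
    (e : nat -> X) (E : normedModType R) (z : nat -> E) :
  conditional_spreading_basis e -> convex_block_homogeneous_part e z ->
  exists coef C, homogeneous_basis e z coef C.
Proof.
move=> [eB _ eC] [N [EN OS xz]].
have SN : seminorm N by case: EN.
have [_ _ [c [C [c0 C0 cC]]]] := EN.
have [coef [K [cl cf cv [K0 cK]]]] := coef_exists eB EN OS.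
have z0 := homogeneous_neq0 eB eC EN OS xz.
have [D D0 tD] := homogeneous_tail eB eC EN OS xz.
have nl1 := basis_not_l1 eB eC EN OS.
(* A coordinate is the difference of two consecutive tails. *)
have aD n (a : nat -> R) k : (k < n)%N -> `|a k| <= 2 * D * `|lincomb z n a|.
  move=> kn; rewrite -[a k](addrK (\sum_(i < n | (k < i)%N) a i)) -tail_sum_rec//.
  rewrite (le_trans (ler_normB _ _))// -mulrA mulr2n mulrDl mul1r.
  by apply: lerD; exact: tD.
have [q [b [qs q0 b0 b1 qb]]] := convex_blocks_dominated SN OS xz nl1 aD.
(* The sum of the constants of the individual estimates, so that it dominates each of them. *)
pose M := K + D + C + C / c + C / `|z 0| + N (e 0) / c + (2 * (2 * D) + 1) / c.
have pos : [/\ 0 < C / c, 0 < C / `|z 0|, 0 <= N (e 0) / c & 0 < (2 * (2 * D) + 1) / c].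
  by rewrite !divr_gt0 ?divr_ge0 ?(sn_ge0 SN) ?ltW// addr_gt0// !mulr_gt0.
have up (r s t : R) : t <= M -> 0 <= s -> r <= t * s -> r <= M * s.
  by move=> tM s0 rt; apply: (le_trans rt); rewrite ler_wpM2r.
have Nle v : N v <= C * `|v| := (cC v).2.
have Nge v : `|v| <= N v / c by rewrite ler_pdivlMr// mulrC (cC v).1.
have cz n (a : nat -> R) kappa : {homo kappa : i j / (i <= j)%N} ->
    `|\sum_(i < n) a i *: z (kappa i)| <= N (lincomb e n a).
  exact: reindex_monotone_le.
exists coef, M; split=> //.
- by case: pos; rewrite /M; lra.
- move=> i; rewrite (le_trans (Nge _))// (one_spreading_term OS).
  by case: pos; rewrite /M; lra.
- by move=> m x; apply: (up _ _ K) => //; case: pos; rewrite /M; lra.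
- move=> n a; apply: (up _ _ (C / `|z 0|)) => //; first by case: pos; rewrite /M; lra.
  rewrite mulrAC ler_pdivlMr// (le_trans (basis_sum EN OS xz _ _))//.
- move=> n a kappa km; apply: (up _ _ C) => //; first by case: pos; rewrite /M; lra.
  exact: le_trans (cz _ _ _ km) _.
- move=> n a kappa P km Pa; apply: (up _ _ (C / c)) => //; first by case: pos; rewrite /M; lra.
  apply: (le_trans (Nge _)); rewrite mulrAC ler_wpM2r ?invr_ge0 ?(ltW c0)//.
  exact: le_trans (zero_sum_suppression SN OS xz km Pa) _.
- by move=> n a j; apply: (up _ _ D) => //; case: pos; rewrite /M; lra.
- move=> d /nl1[n [a [a1 ad]]]; exists n, a; split=> //.
  by apply: le_trans ad; apply: (cz n a id) => ? ?.
- exact: homogeneous_one_spreading OS xz.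
- by move=> n a kappa; exact: homogeneous_reindex_le SN OS xz n a kappa.
- exists q, b; split=> // n a; apply: (up _ _ ((2 * (2 * D) + 1) / c)) => //.
    by case: pos; rewrite /M; lra.
  by apply: (le_trans (Nge _)); rewrite mulrAC ler_wpM2r ?invr_ge0 ?(ltW c0)// qb.
Qed.

(** * Subspaces and operators *)

Section Subspaces.
Variables (R : realType) (X : normedModType R).

Lemma closed_submodP (A : set X) : closed_subspace A <->
  [/\ closed A, A 0 & forall (a : R) x y, A x -> A y -> A (a *: x + y)].
Proof.
split=> [[cA [A0 AD]]|[cA A0 AD]].
  by split=> // [|a x y Ax Ay]; [have := A0; rewrite inE | have := AD a x y; rewrite !inE;
    apply].
by split=> //; split=> [|a x y]; rewrite !inE//; exact: AD.
Qed.

Lemma closed_subspace_sum (A : set X) n (a : nat -> R) (x : nat -> X) :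
  closed_subspace A -> (forall i, A (x i)) -> A (lincomb x n a).
Proof.
move=> /closed_submodP[_ A0 AD] Ax; rewrite /lincomb; elim: n => [|n IH].
  by rewrite big_ord0.
by rewrite big_ord_recr/= addrC; exact: AD.
Qed.

Lemma closed_approx (A : set X) x : closed A ->
  (forall d : R, 0 < d -> exists2 y, A y & `|x - y| < d) -> A x.
Proof.
move=> cA Ax; apply: cA => B /nbhs_ballP[d /= d0 dB].
have [y Ay xy] := Ax d d0; exists y; split=> //; apply: dB.
by rewrite -ball_normE.
Qed.

Lemma closed_spanP (z : nat -> X) x : closed_span z x <->
  forall d : R, 0 < d -> exists n a, `|x - lincomb z n a| < d.
Proof.
split=> [zx d d0|zx].
  have /zx[_ [[n [a ->]]]] : nbhs x (ball x d) by exact: nbhsx_ballx.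
  by rewrite -ball_normE; exists n, a.
apply: closed_approx => [|d d0]; first exact: closed_closure.
have [n [a h]] := zx d d0; exists (lincomb z n a) => //.
by apply: subset_closure; exists n, a.
Qed.

Lemma closed_span_lincomb (z : nat -> X) n a : closed_span z (lincomb z n a).
Proof. by apply: subset_closure; exists n, a. Qed.

End Subspaces.

(** The coefficients are produced before the space and the sequence are given, so the same ones
    serve two sequences at once. *)
Lemma lincomb_linear (R : realType) (a : R) n (b : nat -> R) n' (b' : nat -> R) :
  exists m c, forall (V : lmodType R) (x : nat -> V),
  a *: lincomb x n b + lincomb x n' b' = lincomb x m c.
Proof.
pose cut k (f : nat -> R) i := if (i < k)%N then f i else 0.
have cutE (V : lmodType R) (x : nat -> V) k m f : (k <= m)%N ->
    lincomb x k f = lincomb x m (cut k f).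
  move=> km; rewrite !lincomb_nat (big_cat_nat _ (n := k) (p := m))//=.
  rewrite [X in _ = _ + X]big_nat [X in _ = _ + X]big1 ?addr0.
    by apply: eq_big_nat => i /andP[_ ik]; rewrite /cut ik.
  by move=> i /andP[ki _]; rewrite /cut ltnNge ki scale0r.
exists (maxn n n'), (fun i => a * cut n b i + cut n' b' i) => V x.
rewrite (cutE _ _ n (maxn n n'))// ?leq_maxl// (cutE _ _ n' (maxn n n'))// ?leq_maxr//.
rewrite /lincomb scaler_sumr -big_split/=; apply: eq_bigr => i _.
by rewrite scalerA -scalerDl.
Qed.

Lemma lincomb_delta (R : realType) (V : lmodType R) (z : nat -> V) i :
  lincomb z i.+1 (fun j => (j == i)%:R) = z i.
Proof.
rewrite /lincomb big_ord_recr/= eqxx scale1r big1 ?add0r// => j _.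
by rewrite ltn_eqF// scale0r.
Qed.

Lemma closed_span_mem (R : realType) (X : normedModType R) (z : nat -> X) i :
  closed_span z (z i).
Proof. by rewrite -[z i]lincomb_delta; exact: closed_span_lincomb. Qed.

Lemma closed_span_sub (R : realType) (X : normedModType R) (y : nat -> X) (A : set X) :
  closed_subspace A -> (forall i, A (y i)) -> closed_span y `<=` A.
Proof.
move=> sA Ay u /closed_spanP yu; have [cA _ _] := (closed_submodP A).1 sA.
apply: closed_approx => // d /yu[n [a h]]; exists (lincomb y n a) => //.
exact: closed_subspace_sum.
Qed.

Lemma closed_span_subspace (R : realType) (X : normedModType R) (z : nat -> X) :
  closed_subspace (closed_span z).
Proof.
apply/closed_submodP; split; first exact: closed_closure.
  by have := @closed_span_lincomb _ _ z 0%N (fun=> 0); rewrite /lincomb big_ord0.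
move=> a x y /closed_spanP zx /closed_spanP zy; apply/closed_spanP => d d0.
pose d' := d / (`|a| + 1); have a1 : 0 < `|a| + 1 by rewrite ltr_wpDl.
have d'0 : 0 < d' by exact: divr_gt0.
have [n [b xb]] := zx _ d'0; have [n' [b' yb]] := zy _ d'0.
have [m [c mc]] := lincomb_linear a n b n' b'; exists m, c.
rewrite -mc opprD addrACA -scalerBr (le_lt_trans (ler_normD _ _))// normrZ.
apply: (@le_lt_trans _ _ (`|a| * d' + `|y - lincomb z n' b'|)).
  by rewrite lerD2r ler_wpM2l// ltW.
apply: (@lt_le_trans _ _ (`|a| * d' + d')); first by rewrite ltrD2l.
by rewrite -{2}[d']mul1r -mulrDl /d' mulrC divfK// gt_eqF.
Qed.

(** * Extension of an operator from a sequence to its closed span *)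

Section LinearExtension.
Variables (R : realType) (E : normedModType R) (X : completeNormedModType R).
Variables (z : nat -> E) (y : nat -> X) (C : R).
Hypothesis C0 : 0 <= C.
Hypothesis yz : forall n a, `|lincomb y n a| <= C * `|lincomb z n a|.

(** The closure of the pairs of combinations with equal coefficients; the domination makes it the
    graph of a bounded operator on [closed_span z]. *)
Let graph (u : E) (x : X) := forall d : R, 0 < d -> exists n a,
  `|u - lincomb z n a| < d /\ `|x - lincomb y n a| < d.

Let graph_lin (a : R) u x u' x' : graph u x -> graph u' x' ->
  graph (a *: u + u') (a *: x + x').
Proof.
move=> ux ux' d d0.
pose d' := d / (`|a| + 1); have a1 : 0 < `|a| + 1 by rewrite ltr_wpDl.
have d'0 : 0 < d' by exact: divr_gt0.
have [n [b [ub xb]]] := ux _ d'0; have [n' [b' [ub' xb']]] := ux' _ d'0.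
have [m [c mc]] := lincomb_linear a n b n' b'; exists m, c; rewrite -!mc.
have h (V : normedModType R) (v w v' w' : V) : `|v - w| < d' -> `|v' - w'| < d' ->
    `|a *: v + v' - (a *: w + w')| < d.
  move=> vw vw'; rewrite opprD addrACA -scalerBr (le_lt_trans (ler_normD _ _))// normrZ.
  apply: (@le_lt_trans _ _ (`|a| * d' + `|v' - w'|)).
    by rewrite lerD2r ler_wpM2l// ltW.
  apply: (@lt_le_trans _ _ (`|a| * d' + d')); first by rewrite ltrD2l.
  by rewrite -{2}[d']mul1r -mulrDl /d' mulrC divfK// gt_eqF.
by split; exact: h.
Qed.

Let graph_bound u x : graph u x -> `|x| <= C * `|u|.
Proof.
move=> ux; apply/ler_addgt0Pr => d d0.
have [|n [a [ua xa]]] := ux (d / (C + 1)); first by rewrite divr_gt0// ltr_wpDl.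
have h1 : `|x| <= `|lincomb y n a| + `|x - lincomb y n a|.
  by rewrite -{1}(subrK (lincomb y n a) x) addrC ler_normD.
have h2 : `|lincomb z n a| <= `|u| + `|u - lincomb z n a|.
  by rewrite -{1}(subKr u (lincomb z n a)) ler_normB.
have h3 := yz n a; have h4 : d = (C + 1) * (d / (C + 1)).
  by rewrite mulrC divfK// gt_eqF// ltr_wpDl.
set d' := d / _ in ua xa h4.
have h5 : C * `|lincomb z n a| <= C * (`|u| + d').
  by rewrite ler_wpM2l// (le_trans h2)// lerD2l ltW.
rewrite h4; move: h1 h3 h5 xa; clearbody d'; lra.
Qed.

Let graph_exists u : closed_span z u -> exists x, graph u x.
Proof.
move=> /closed_spanP zu.
have /choice[na Hna] : forall k, exists na : nat * (nat -> R),
    `|u - lincomb z na.1 na.2| < k.+1%:R^-1.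
  by move=> k; have [|n [a h]] := zu k.+1%:R^-1; [rewrite invr_gt0|exists (n, a)].
pose w k := lincomb y (na k).1 (na k).2; pose v k := lincomb z (na k).1 (na k).2.
have wv k l : `|w k - w l| <= C * `|v k - v l|.
  have [m [c mc]] := lincomb_linear (-1) (na l).1 (na l).2 (na k).1 (na k).2.
  by rewrite [w k - _]addrC [v k - _]addrC -(scaleN1r (w l)) -(scaleN1r (v l)) /w /v !mc.
have small (d : R) : 0 < d -> \forall k \near \oo, k.+1%:R^-1 < d.
  by move=> d0; exact: near_infty_natSinv_lt (PosNum d0).
have w_cvg : cvg (w @ \oo).
  apply: cauchy_cvg; apply: cauchy_exP => d d0.
  pose d' := d / (2 * (C + 1)).
  have C1 : 0 < C + 1 by rewrite ltr_wpDl.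
  have d'0 : 0 < d' by rewrite divr_gt0// mulr_gt0.
  have [K _ HK] := small d' d'0; exists (w K); exists K => // k /= Kk.
  rewrite -ball_normE /=; apply: (le_lt_trans (wv _ _)).
  have h : `|v K - v k| < 2 * d'.
    rewrite -(subrKA u) (le_lt_trans (ler_normD _ _))// mulr2n mulrDl mul1r ltrD//.
      by rewrite distrC (lt_trans (Hna K))// HK//=.
    by rewrite (lt_trans (Hna k))// HK.
  have dE : d = (C + 1) * (2 * d') by rewrite /d'; field; rewrite gt_eqF.
  rewrite dE; apply: (le_lt_trans (ler_wpM2l C0 (ltW h))).
  by rewrite (mulrDl C) mul1r ltrDl mulr_gt0.
exists (lim (w @ \oo)) => d d0.
have /cvgrPdist_lt/(_ d d0) := w_cvg.
move=> [K1 _ H1]; have [K2 _ H2] := small d d0.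
exists (na (maxn K1 K2)).1, (na (maxn K1 K2)).2; split.
  by rewrite (lt_trans (Hna _))// H2//= leq_maxr.
by have := H1 (maxn K1 K2); apply => /=; rewrite leq_maxl.
Qed.

Lemma linear_extension : exists T : E -> X,
  [/\ linear_on (closed_span z) T,
      forall u, closed_span z u -> `|T u| <= C * `|u|,
      forall n a, T (lincomb z n a) = lincomb y n a &
      forall u, closed_span z u -> closed_span y (T u)].
Proof.
have [T HT] : exists T, forall u, closed_span z u -> graph u (T u).
  have /choice[T HT] : forall u, exists x, closed_span z u -> graph u x.
    move=> u; have [zu|nzu] := pselect (closed_span z u); last by exists 0.
    by have [x ux] := graph_exists zu; exists x.
  by exists T.
have uniq u x : closed_span z u -> graph u x -> T u = x.
  move=> zu ux; apply/eqP; rewrite -subr_eq0 -normr_le0.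
  have := graph_bound (graph_lin (-1) ux (HT u zu)).
  by rewrite !scaleN1r addNr normr0 mulr0 addrC.
have [_ _ Zlin] := (closed_submodP _).1 (closed_span_subspace z).
exists T; split.
- move=> a u v zu zv; apply: uniq; first exact: Zlin.
  by apply: graph_lin; exact: HT.
- by move=> u zu; apply: graph_bound; exact: HT.
- move=> n a; apply: uniq; first exact: closed_span_lincomb.
  by move=> d d0; exists n, a; rewrite !subrr !normr0.
- move=> u zu; apply/closed_spanP => d d0.
  by have [n [a [_ h]]] := HT u zu d d0; exists n, a.
Qed.

End LinearExtension.

Lemma half_summable (R : realType) (X : completeNormedModType R) (y : nat -> X) (M : R) :
  0 <= M -> (forall k, `|y k| <= M * 2^-1 ^+ k) ->
  exists2 l, \sum_(k < n) y k @[n --> \oo] --> l & `|l| <= M * 2.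
Proof.
move=> M0 yM.
have h2 : `|2^-1 : R| < 1 by rewrite ger0_norm ?invr_ge0// invf_lt1// ltr1n.
have cy : cvg (series y @ \oo).
  apply: normed_cvg; apply: (series_le_cvg _ _ _ (is_cvg_geometric_series (a := M) h2)).
  - by move=> n; exact: normr_ge0.
  - by move=> n; rewrite mulr_ge0// exprn_ge0// invr_ge0.
  - by move=> n; exact: yM.
have e : series y = fun n => \sum_(k < n) y k.
  by apply/funext => n; rewrite /series/= big_mkord.
rewrite e in cy; exists (lim ((fun n => \sum_(k < n) y k) @ \oo)) => //.
apply: (ler_cvg_to (cvg_norm cy) (cvg_cst (M * 2))); apply: nearW => n.
apply: (le_trans (ler_norm_sum _ _ _)).
apply: (@le_trans _ _ (\sum_(k < n) M * 2^-1 ^+ k)); first by apply: ler_sum.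
by rewrite -mulr_sumr ler_wpM2l// sum_half_le2.
Qed.

(** * Boundedness of the projection of a direct sum *)

Section Projection.
Variables (R : realType) (X : completeNormedModType R).
Variables (P : X -> X).
Hypothesis P_lin : forall (a : R) x y, P (a *: x + y) = a *: P x + P y.

Let P0 : P 0 = 0.
Proof. by have := P_lin (-1) 0 0; rewrite scaler0 addr0 scaleN1r addNr. Qed.

Let PB x y : P (x - y) = P x - P y.
Proof. by rewrite addrC -scaleN1r P_lin scaleN1r addrC. Qed.

Let PZ (a : R) x : P (a *: x) = a *: P x.
Proof. by have := P_lin a x 0; rewrite P0 !addr0. Qed.

(* Baire: some sublevel set of [|P x|] is dense in a ball. *)
Lemma dense_sublevel : exists2 M : R, 0 < M & forall v (d : R), 0 < d ->
  exists2 u, `|P u| <= M * `|v| & `|v - u| < d.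
Proof.
pose A n := [set x | `|P x| <= n%:R].
have [n nd] : exists n, ~ dense (~` closure (A n)).
  apply: contrapT => /forallNP/= H.
  have : dense (\bigcap_n ~` closure (A n)).
    apply: Baire => n; split; last by apply: contrapT; exact: H.
    exact/closed_openC/closed_closure.
  move=> /(_ setT); case=> [|| x [_ Hx]]; [by exists 0 | exact: openT |].
  apply: (Hx (Num.truncn `|P x|).+1) => //; apply: subset_closure.
  by rewrite /A /=; apply/ltW; exact: truncnS_gt.
have [B [[x0 Bx0] BA]] := denseNE nd.
have /nbhs_ballP[r /= r0 rB] : nbhs x0 B by exact: open_nbhs_nbhs.
have cA x : `|x0 - x| < r -> closure (A n) x.
  move=> xr; apply: contrapT => nA.
  suff : (B `&` ~` closure (A n)) x by rewrite BA.
  by split=> //; apply: rB; rewrite -ball_normE.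
have close x (d : R) : `|x0 - x| < r -> 0 < d -> exists2 a, `|P a| <= n%:R & `|x - a| < d.
  move=> /cA xA d0; have [a [Aa xa]] := xA _ (nbhsx_ballx x d d0).
  by exists a => //; move: xa; rewrite -ball_normE.
(* [x0 + s *: v] and [x0] are approximated by points of [A n], whose difference is rescaled by
   [s^-1 = 2 |v| / r]. Using [n.+1] keeps [M] positive. *)
pose M := 2 * n.+1%:R * (2 / r); exists M => [|v d d0].
  by rewrite !mulr_gt0// ?invr_gt0// ltr0n.
have [->|v0] := eqVneq v 0; first by exists 0; rewrite ?P0 ?normr0 ?mulr0 ?subrr ?normr0.
have nv : 0 < `|v| by rewrite normr_gt0.
pose s := r / 2 / `|v|.
have s0 : 0 < s by rewrite !divr_gt0.
have d'0 : 0 < d * s / 2 by rewrite divr_gt0// mulr_gt0.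
have [|a aA av] := close (x0 + s *: v) _ _ d'0.
  rewrite opprD addrA subrr add0r normrN normrZ gtr0_norm// /s divfK ?gt_eqF//.
  by rewrite ltr_pdivrMr// mulr2n mulrDr mulr1 ltrDl.
have [|b bA bv] := close x0 _ _ d'0; first by rewrite subrr normr0.
exists (s^-1 *: (a - b)).
  rewrite PZ normrZ gtr0_norm ?invr_gt0// PB.
  have -> : M * `|v| = s^-1 * (2 * n.+1%:R).
    by rewrite /M /s; field; rewrite !gt_eqF.
  rewrite ler_wpM2l ?invr_ge0 ?(ltW s0)// (le_trans (ler_normB _ _))//.
  by rewrite mulr2n mulrDl mul1r lerD// (le_trans aA _, le_trans bA _)// ler_nat.
have -> : v - s^-1 *: (a - b) = s^-1 *: ((x0 + s *: v - a) - (x0 - b)).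
  have -> : x0 + s *: v - a - (x0 - b) = s *: v - (a - b).
    rewrite !opprB !addrA [_ - a + b]addrAC [_ - a - x0]addrAC; congr (_ - a).
    by rewrite [x0 + _]addrC [_ + x0 + b]addrAC addrK.
  by rewrite [RHS]scalerBr scalerA mulVf ?gt_eqF// scale1r.
rewrite normrZ gtr0_norm ?invr_gt0// mulrC ltr_pdivrMr//.
apply: (le_lt_trans (ler_normB _ _)); rewrite [ltRHS](_ : _ = d * s / 2 + d * s / 2);
  first exact: ltrD.
by field.
Qed.

(** Successive approximation as in the open mapping theorem: x is a sum of vectors [u k] with
    [P (u k)] geometrically small. The sum [y] of these images lies in Y and [x - y] lies in W by
    closedness, which forces [P x = y]. *)
Lemma projection_bounded (Y W : set X) : closed_subspace Y -> closed_subspace W ->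
  (forall y w, Y y -> W w -> P (y + w) = y) ->
  (forall x, Y (P x)) -> (forall x, W (x - P x)) ->
  exists2 C : R, 0 < C & forall x, `|P x| <= C * `|x|.
Proof.
move=> sY sW PYW PY PW; have [M M0 HM] := dense_sublevel.
have unit x : `|x| <= 1 -> `|P x| <= M * 2.
  move=> x1.
  have /choice[f Hf] : forall vk : X * nat, exists u,
      `|P u| <= M * `|vk.1| /\ `|vk.1 - u| < 2^-1 ^+ vk.2.+1.
    move=> [v k]; have [|u Pu vu] := HM v (2^-1 ^+ k.+1); last by exists u.
    by rewrite exprn_gt0// invr_gt0.
  (* The remainder after k approximations, of norm at most 2^-k. *)
  pose fix r k := if k is k'.+1 then r k' - f (r k', k') else x.
  have r_le k : `|r k| <= 2^-1 ^+ k.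
    by case: k => [|k] /=; [rewrite expr0 | have [_ /ltW] := Hf (r k, k)].
  pose u k := f (r k, k).
  have sum_u n : \sum_(k < n) u k = x - r n.
    elim: n => [|n IH]; first by rewrite big_ord0 /= subrr.
    by rewrite big_ord_recr/= IH /u opprB addrA addrAC.
  have r_cvg : r n @[n --> \oo] --> 0.
    apply/norm_cvg0P; apply: (@squeeze_cvgr _ _ _ _ (fun=> 0) (geometric 1 2^-1)).
    - by apply: nearW => n; rewrite normr_ge0 /geometric /= mul1r r_le.
    - exact: cvg_cst.
    - by apply: cvg_geometric; rewrite ger0_norm ?invr_ge0// invf_lt1// ltr1n.
  have Pu k : `|P (u k)| <= M * 2^-1 ^+ k.
    have [h _] := Hf (r k, k); apply: (le_trans h); apply: ler_wpM2l (r_le k).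
    exact: ltW.
  have [y yl yM] := half_summable (ltW M0) Pu.
  suff -> : P x = y by [].
  have Yy : Y y.
    have [cY _ _] := (closed_submodP Y).1 sY.
    apply: (closed_cvg Y cY _ y yl); apply: nearW => n.
    have := closed_subspace_sum n (fun=> 1) sY (fun k => PY (u k)).
    by rewrite /lincomb; under eq_bigr do rewrite scale1r.
  have Wxy : W (x - y).
    have [cW _ _] := (closed_submodP W).1 sW.
    have h : (x - r n) - \sum_(k < n) P (u k) @[n --> \oo] --> (x - 0) - y.
      by apply: cvgB => //; apply: cvgB => //; exact: cvg_cst.
    rewrite -(subr0 x); apply: (closed_cvg W cW _ _ h); apply: nearW => n.
    rewrite -sum_u -sumrB.
    have := closed_subspace_sum n (fun=> 1) sW (fun k => PW (u k)).
    by rewrite /lincomb; under eq_bigr do rewrite scale1r.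
  by rewrite -(PYW y (x - y))// addrC subrK.
exists (M * 2) => [|x]; first exact: mulr_gt0.
have [->|x0] := eqVneq x 0; first by rewrite P0 !normr0 mulr0.
have nx : 0 < `|x| by rewrite normr_gt0.
rewrite -ler_pdivrMr// mulrC -[X in X * _](gtr0_norm (x := `|x|^-1)) ?invr_gt0// -normrZ -PZ.
by apply: unit; rewrite normrZ gtr0_norm ?invr_gt0// mulVf// gt_eqF.
Qed.
End Projection.

Lemma direct_sum_projection (R : realType) (X : completeNormedModType R)
    (Y W : set X) : direct_sum Y W -> exists (P : X -> X) (C : R),
  [/\ forall (a : R) x y, P (a *: x + y) = a *: P x + P y,
      0 < C, forall x, `|P x| <= C * `|x|, forall x, Y (P x) &
      [/\ forall x, W (x - P x), forall y, Y y -> P y = y & forall w, W w -> P w = 0]].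
Proof.
move=> [sY sW YW YWT].
have /choice[P HP] : forall x, exists y, Y y /\ W (x - y).
  move=> x; have : [set: X] x by []. rewrite -YWT => -[y Yy [w Ww <-]].
  by exists y; rewrite addrAC subrr add0r.
have [_ Y0 YD] := (closed_submodP Y).1 sY; have [_ W0 WD] := (closed_submodP W).1 sW.
have PYW y w : Y y -> W w -> P (y + w) = y.
  move=> Yy Ww; have [Y1 W1] := HP (y + w).
  suff : (Y `&` W) (P (y + w) - y) by rewrite YW => /subr0_eq.
  split; first by rewrite addrC -scaleN1r; exact: YD.
  have := WD (-1) _ _ W1 Ww.
  by rewrite scaleN1r opprB opprD addrA subrK.
have lin (a : R) x y : P (a *: x + y) = a *: P x + P y.
  have -> : a *: x + y = (a *: P x + P y) + (a *: (x - P x) + (y - P y)).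
    by rewrite addrACA -scalerDr addrC subrKC addrC subrKC.
  by apply: PYW; [apply: YD | apply: WD]; by case: (HP x); case: (HP y).
have [C C0 HC] := projection_bounded lin sY sW PYW (fun x => (HP x).1) (fun x => (HP x).2).
exists P, C; split=> //; first by move=> x; case: (HP x).
split=> [x|y Yy|w Ww]; first by case: (HP x).
  by rewrite -{1}(addr0 y) PYW.
by rewrite -(add0r w) PYW.
Qed.

(** * Bounded linear maps on a closed subspace *)

Section WithinContinuity.
Variables (R : realType) (V V' : normedModType R) (A : set V) (f : V -> V').
Hypotheses (sA : closed_subspace A) (fA : linear_on A f).

Let A0 : A 0. Proof. by have [] := (closed_submodP A).1 sA. Qed.
Let AD (a : R) x y : A x -> A y -> A (a *: x + y).
Proof. by have [_ _] := (closed_submodP A).1 sA; apply. Qed.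

Lemma linear_on0 : f 0 = 0.
Proof. by have := fA (-1) A0 A0; rewrite scaler0 addr0 scaleN1r addNr. Qed.

Lemma linear_onZ (a : R) x : A x -> f (a *: x) = a *: f x.
Proof. by move=> Ax; have := fA a Ax A0; rewrite linear_on0 !addr0. Qed.

Lemma linear_onB x y : A x -> A y -> f (x - y) = f x - f y.
Proof. by move=> Ax Ay; rewrite addrC -scaleN1r fA// scaleN1r addrC. Qed.

Lemma linear_on_lincomb (z : nat -> V) n (a : nat -> R) : (forall i, A (z i)) ->
  f (lincomb z n a) = lincomb (f \o z) n a.
Proof.
move=> Az; elim: n => [|n IH]; first by rewrite /lincomb !big_ord0 linear_on0.
rewrite /lincomb !big_ord_recr/= addrC fA//; last exact: (closed_subspace_sum n a sA Az).
by rewrite addrC; congr (_ + _).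
Qed.

Lemma within_continuous_bounded : {within A, continuous f} ->
  exists2 C : R, 0 < C & forall x, A x -> `|f x| <= C * `|x|.
Proof.
move=> /subspace_continuousP/(_ 0 A0)/cvgrPdist_lt/(_ 1 ltr01).
rewrite /within/= => /nbhs_ballP[d /= d0 dA]; exists (2 / d) => [|x Ax]; first exact: divr_gt0.
have [->|x0] := eqVneq x 0; first by rewrite linear_on0 !normr0 mulr0.
have nx : 0 < `|x| by rewrite normr_gt0.
pose s := d / 2 / `|x|; have s0 : 0 < s by rewrite !divr_gt0.
have sAx : A (s *: x) by have := AD s Ax A0; rewrite addr0.
have /dA/(_ sAx) : ball 0 d (s *: x).
  rewrite -ball_normE/= sub0r normrN normrZ gtr0_norm// /s divfK ?gt_eqF//.
  by rewrite ltr_pdivrMr// mulr2n mulrDr mulr1 ltrDl.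
rewrite -linear_onB// sub0r -scaleN1r linear_onZ// scaleN1r normrN linear_onZ// normrZ
  gtr0_norm// mulrC -ltr_pdivlMr// => /ltW.
by move=> h; apply: (le_trans h); rewrite le_eqVlt; apply/orP; left; apply/eqP; rewrite /s;
  field; rewrite !gt_eqF.
Qed.

Lemma bounded_within_continuous (C : R) : 0 < C ->
  (forall x, A x -> `|f x| <= C * `|x|) -> {within A, continuous f}.
Proof.
move=> C0 fC; apply/subspace_continuousP => x Ax; apply/cvgrPdist_lt => d d0.
rewrite /within/=; apply/nbhs_ballP; exists (d / C) => /=; first exact: divr_gt0.
move=> y; rewrite -ball_normE /= => xy Ay; rewrite -linear_onB//.
apply: (le_lt_trans (fC _ _)).
  by have := AD (-1) Ay Ax; rewrite scaleN1r addrC.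
by rewrite mulrC -ltr_pdivlMr.
Qed.

End WithinContinuity.

(* [S T] is invertible on Z, so [T (S T)^-1 S] is a projection of X onto T(Z). *)
Lemma complemented_copy_criterion (R : realType) (X E : completeNormedModType R)
    (Y : set X) (Z : set E) (S : X -> E) (T : E -> X) (Cs Ct : R) :
  closed_subspace Z ->
  (forall (a : R) x y, S (a *: x + y) = a *: S x + S y) ->
  0 < Cs -> (forall x, `|S x| <= Cs * `|x|) -> (forall x, Z (S x)) ->
  linear_on Z T -> 0 < Ct -> (forall u, Z u -> `|T u| <= Ct * `|u|) ->
  (forall u, Z u -> Y (T u)) ->
  (forall u, Z u -> `|S (T u) - u| <= 2^-1 * `|u|) ->
  contains_complemented_copy Y Z.
Proof.
move=> sZ Slin Cs0 Sb SZ Tlin Ct0 Tb TY ST.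
have [cZ Z0 ZD] := (closed_submodP Z).1 sZ.
have S0 : S 0 = 0 by have := Slin (-1) 0 0; rewrite scaler0 addr0 scaleN1r addNr.
have SB x y : S (x - y) = S x - S y by rewrite addrC -scaleN1r Slin scaleN1r addrC.
have ZB u v : Z u -> Z v -> Z (u - v).
  by move=> Zu Zv; rewrite addrC -scaleN1r; exact: ZD.
have TB := linear_onB Tlin.
have low u : Z u -> `|u| <= 2 * `|S (T u)|.
  move=> Zu; have := ST u Zu; have : `|u| <= `|S (T u)| + `|S (T u) - u|.
    by rewrite -{1}(subKr (S (T u)) u) ler_normB.
  lra.
(* A solution is a fixed point of [f], which is a contraction of ratio 1/2 because S T is that close
   to the identity. *)
have solve v : Z v -> exists u, Z u /\ S (T u) = v.
  move=> Zv; pose f u := u - S (T u) + v.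
  have fZ : {homo f : u / Z u >-> Z u}.
    move=> u Zu; rewrite /f -[_ - _]scale1r; apply: ZD => //; exact: ZB.
  have [|//||u Zu uE] := @banach_fixed_point R E Z (mkfun_fun fZ).
  - exists (2^-1)%:nng; split=> /=; first by rewrite invf_lt1// ltr1n.
    move=> [u w] [/= Zu Zw]; rewrite /mkfun/= /f.
    rewrite opprD addrACA subrr addr0.
    rewrite (_ : u - _ - _ = (u - w) - S (T (u - w))); last first.
      by rewrite TB// SB [in LHS]opprD [in RHS]opprD addrACA.
    by rewrite distrC; apply: ST; exact: ZB.
  - by exists 0.
  exists u; split=> //; move: uE; rewrite /= /mkfun /f => /eqP.
  by rewrite -subr_eq0 opprD opprB addrA addrCA subrr addr0 subr_eq0 => /eqP.
have /choice[g Hg] : forall x, exists u, Z u /\ S (T u) = S x by move=> x; exact: solve.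
have inj u v : Z u -> Z v -> S (T u) = S (T v) -> u = v.
  move=> Zu Zv e; apply/eqP; rewrite -subr_eq0 -normr_le0.
  by apply: (le_trans (low _ (ZB _ _ Zu Zv))); rewrite TB// SB e subrr normr0 mulr0.
have glin (a : R) x y : g (a *: x + y) = a *: g x + g y.
  have [Zx Sx] := Hg x; have [Zy Sy] := Hg y; have [Zxy Sxy] := Hg (a *: x + y).
  by apply: inj => //; [exact: ZD | rewrite Sxy Slin Tlin// Slin Sx Sy].
have gb x : `|g x| <= 2 * Cs * `|x|.
  have [Zx Sx] := Hg x; apply: (le_trans (low _ Zx)).
  by rewrite Sx -mulrA ler_wpM2l.
have gT u : Z u -> g (T u) = u by move=> Zu; have [Zx Sx] := Hg (T u); exact: inj.
(* The fixed points of [Q] form the copy and its kernel the complement; both are closed, as kernels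
   of the bounded maps [1 - Q] and [Q]. *)
pose Q x := T (g x).
have Qlin (a : R) x y : Q (a *: x + y) = a *: Q x + Q y.
  by rewrite /Q glin Tlin//; [case: (Hg x) | case: (Hg y)].
have QB x y : Q (x - y) = Q x - Q y by rewrite addrC -scaleN1r Qlin scaleN1r addrC.
have Qb x : `|Q x| <= Ct * (2 * Cs) * `|x|.
  have [Zx _] := Hg x; apply: (le_trans (Tb _ Zx)).
  by rewrite -mulrA ler_wpM2l// ltW.
have sub_closed (F : X -> X) (D : R) : 0 < D -> (forall x, `|F x| <= D * `|x|) ->
    (forall (a : R) x y, F (a *: x + y) = a *: F x + F y) ->
    closed_subspace [set x | F x = 0].
  move=> D0 FD Flin.
  have F0 : F 0 = 0 by have := Flin (-1) 0 0; rewrite scaler0 addr0 scaleN1r addNr.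
  have FB x y : F (x - y) = F x - F y by rewrite addrC -scaleN1r Flin scaleN1r addrC.
  apply/closed_submodP; split=> //=; last first.
    by move=> a x y Fx Fy; rewrite Flin Fx Fy scaler0 addr0.
  move=> x xcl; apply/eqP; rewrite -normr_le0; apply/ler_addgt0Pr => d d0.
  have [y [/= Fy]] := xcl _ (nbhsx_ballx x (d / D) (divr_gt0 d0 D0)).
  rewrite -ball_normE/= => xy; rewrite add0r -(subr0 (F x)) -Fy -FB.
  by apply: (le_trans (FD _)); rewrite mulrC -ler_pdivlMr// ltW.
have Zp : closed_subspace [set x | Q x = x].
  rewrite (_ : [set x | _] = [set x | x - Q x = 0]); last first.
    by apply/seteqP; split=> x /=; [move=> ->; rewrite subrr | move=> /subr0_eq].
  apply: (sub_closed (fun x => x - Q x) (1 + Ct * (2 * Cs))).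
  - by rewrite addr_gt0// !mulr_gt0.
  - by move=> x; rewrite (le_trans (ler_normB _ _))// mulrDl mul1r lerD2l.
  - by move=> a x y; rewrite Qlin scalerBr opprD addrACA.
have Kp : closed_subspace [set x | Q x = 0].
  by apply: (sub_closed Q (Ct * (2 * Cs))) => //; rewrite !mulr_gt0.
exists [set x | Q x = x]; first by move=> x /= <-; apply: TY; case: (Hg x).
split=> //.
- exists g, T; split.
  + by move=> a x y _ _; exact: glin.
  + by move=> x _; case: (Hg x).
  + by move=> u Zu; rewrite /= /Q gT.
  + by split=> [x|u]; rewrite inE//; exact: gT.
  + split.
      have gl : linear_on [set x | Q x = x] g by move=> a x y _ _; exact: glin.
      apply: (@bounded_within_continuous _ _ _ _ _ Zp gl (2 * Cs)) => //.
      by rewrite mulr_gt0.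
    exact: (@bounded_within_continuous _ _ _ _ _ sZ Tlin Ct).
- exists [set x | Q x = 0]; split=> //.
  + apply/seteqP; split=> x /=; first by move=> [Qx Q0]; rewrite -Qx.
    by move=> ->; split; rewrite /Q -[RHS](subrr (Q 0)) -QB subrr.
  + apply/seteqP; split=> // x _; exists (Q x); last first.
      by exists (x - Q x); [rewrite /= QB /Q gT ?subrr//; case: (Hg x) | rewrite addrC subrK].
    by rewrite /= /Q gT//; case: (Hg x).
Qed.

(** The sequence is the image of [z] under [g], which is linear as the inverse of a linear map;
    continuity of both maps gives the two bounds. *)
Lemma copy_sequence (R : realType) (X E : normedModType R) (Y : set X)
    (z : nat -> E) : contains_copy Y (closed_span z) ->
  exists (x : nat -> X) (C : R), [/\ 0 < C,
    forall n a, Y (lincomb x n a),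
    forall n a, `|lincomb x n a| <= C * `|lincomb z n a| &
    forall n a, `|lincomb z n a| <= C * `|lincomb x n a|].
Proof.
move=> [Z' Z'Y [sZ' [f [g [flin fS gS [fg gf] [fc gc]]]]]].
have sZ := closed_span_subspace z.
have glin : linear_on (closed_span z) g.
  move=> a u v Zu Zv.
  have [_ _ ZD'] := (closed_submodP Z').1 sZ'; have [_ _ ZD] := (closed_submodP _).1 sZ.
  have gfE w : closed_span z w -> f (g w) = w by move=> Zw; rewrite gf// inE.
  have -> : g (a *: u + v) = g (f (a *: g u + g v)).
    by rewrite flin ?gfE//; exact: gS.
  by rewrite fg// inE; apply: ZD'; exact: gS.
have [C1 C10 H1] := within_continuous_bounded sZ' flin fc.
have [C2 C20 H2] := within_continuous_bounded sZ glin gc.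
have Zz i : closed_span z (z i) by exact: closed_span_mem.
have gE n a : lincomb (g \o z) n a = g (lincomb z n a).
  by rewrite (linear_on_lincomb sZ glin).
have ZL n a := @closed_span_lincomb _ _ z n a.
exists (g \o z), (C1 + C2); split.
- exact: addr_gt0.
- by move=> n a; rewrite gE; apply: Z'Y; exact: gS.
- move=> n a; rewrite gE; apply: (le_trans (H2 _ (ZL n a))).
  by rewrite ler_wpM2r// lerDr ltW.
- move=> n a; rewrite gE -{1}(gf (lincomb z n a)) ?inE//.
  apply: (le_trans (H1 _ (gS _ (ZL n a)))).
  by rewrite ler_wpM2r// lerDl ltW.
Qed.

(** * Escaping mass *)

(** Abel summation. *)
Lemma tail_exchange (R : realType) (V : lmodType R) n (c : nat -> R) (u : nat -> V) :
  \sum_(l < n) c l *: (\sum_(j < l) u j) =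
  \sum_(j < n) (\sum_(l < n | (j < l)%N) c l) *: u j.
Proof.
elim: n => [|n IH]; first by rewrite !big_ord0.
rewrite !big_ord_recr/= {}IH [X in _ = _ + X *: _]big1 ?scale0r ?addr0; last first.
  by move=> l; rewrite ltnNge -ltnS ltn_ord.
rewrite scaler_sumr -big_split/=; apply: eq_bigr => j _.
by rewrite [in RHS]big_mkcond big_ord_recr/= ltn_ord -big_mkcond/= scalerDl.
Qed.

Lemma cvg_ord_sum (R : realType) (V : normedModType R) (T : Type)
    (F : set_system T) (FF : Filter F) (f : nat -> T -> V) (l : nat -> V) n :
  (forall i, f i k @[k --> F] --> l i) ->
  \sum_(i < n) f i k @[k --> F] --> \sum_(i < n) l i.
Proof.
move=> fl; elim: n => [|n IH].
  by rewrite big_ord0; under eq_fun do rewrite big_ord0; exact: cvg_cst.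
rewrite big_ord_recr/=; under eq_fun do rewrite big_ord_recr/=.
exact: cvgD.
Qed.

Section EscapingMass.
Variables (R : realType) (X : completeNormedModType R) (E : normedModType R).
Variables (e : nat -> X) (z : nat -> E) (coef : X -> nat -> R) (C : R).
Hypothesis hb : homogeneous_basis e z coef C.

Let C0 : 0 < C := hb_gt0 hb.

Lemma sum_diff_le n m (a b : nat -> R) :
  `|\sum_(i < n) a i - \sum_(i < m) b i| <= C * `|lincomb e n a - lincomb e m b|.
Proof.
have [k [c kc]] := lincomb_linear (-1) m b n a.
have lE (f : nat -> R) j : \sum_(i < j) f i = lincomb (fun=> 1 : R^o) j f.
  by apply: eq_bigr => i _; rewrite /GRing.scale/= mulr1.
rewrite [lincomb e n a - _]addrC -(scaleN1r (lincomb e m b)) kc.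
apply: le_trans (hb_sum hb _ _); rewrite !lE addrC -(scaleN1r (lincomb _ m b)).
by rewrite kc.
Qed.

Definition partial_sum m (x : X) : R := \sum_(i < m) coef x i.

(** The bounded functional s with value 1 on every [e i]; [hb_sum] makes the partial sums Cauchy, so
    the limit exists. *)
Definition total_sum (x : X) : R := lim (partial_sum m x @[m --> \oo]).

Lemma cvg_total_sum x : partial_sum m x @[m --> \oo] --> total_sum x.
Proof.
apply: cauchy_cvg; apply: cauchy_exP => d d0.
have /cvgrPdist_lt/(_ (d / C / 2)) := @hb_cvg _ _ _ _ _ _ _ hb x.
case=> [|K _ HK]; first by rewrite !divr_gt0.
exists (partial_sum K x); exists K => // m /= Km; rewrite -ball_normE/=.
apply: (le_lt_trans (sum_diff_le _ _ _ _)); rewrite mulrC -ltr_pdivlMr//.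
rewrite -(subrKA x) (le_lt_trans (ler_normD _ _))// [d / C]splitr ltrD//.
  by rewrite distrC; apply: HK => /=.
exact: HK.
Qed.

Lemma total_sum_dist m x :
  `|total_sum x - partial_sum m x| <= C * `|x - lincomb e m (coef x)|.
Proof.
have h1 : `|partial_sum n x - partial_sum m x| @[n --> \oo] -->
    `|total_sum x - partial_sum m x|.
  by apply: cvg_norm; apply: cvgB; [exact: cvg_total_sum | exact: cvg_cst].
have h2 : C * `|lincomb e n (coef x) - lincomb e m (coef x)| @[n --> \oo] -->
    C * `|x - lincomb e m (coef x)|.
  apply: cvgM; first exact: cvg_cst.
  by apply: cvg_norm; apply: cvgB; [exact: (hb_cvg hb) | exact: cvg_cst].
by apply: (ler_cvg_to h1 h2); apply: nearW => n; exact: sum_diff_le.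
Qed.

Lemma total_sum_linear (a : R) x y : total_sum (a *: x + y) = a * total_sum x + total_sum y.
Proof.
apply: cvg_lim => //.
have h : a * partial_sum m x + partial_sum m y @[m --> \oo] --> a * total_sum x + total_sum y.
  apply: cvgD; last exact: cvg_total_sum.
  by apply: cvgM; [exact: cvg_cst | exact: cvg_total_sum].
apply: cvg_trans h; apply: near_eq_cvg; apply: nearW => m.
rewrite /partial_sum mulr_sumr -big_split/=; apply: eq_bigr => i _.
by rewrite (hb_linear hb).
Qed.

Lemma partial_sum_bound m x : `|partial_sum m x| <= C * C * `|x|.
Proof.
apply: (le_trans (hb_sum hb _ _)); rewrite -mulrA ler_wpM2l ?(ltW C0)//.
exact: (hb_bounded hb).
Qed.

Variable U : set_system nat.
Hypothesis UU : UltraFilter U.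
Hypothesis Uoo : \oo `<=` U.

(** A relation, since the limits along [U] need not exist for every sequence. [A] is the mass that
    stays on the coordinatewise limit [a], and [S] is the limit of the total masses. *)
Definition escaping_mass (x : nat -> X) (beta : R) : Prop :=
  exists (a : nat -> R) (A S : R),
  [/\ forall i, coef (x k) i @[k --> U] --> a i,
      \sum_(i < m) a i @[m --> U] --> A,
      total_sum (x k) @[k --> U] --> S & beta = S - A].

Lemma ultra_bounded_cvg (f : nat -> R) (B : R) : (forall k, `|f k| <= B) ->
  exists2 l, f k @[k --> U] --> l & `|l| <= B.
Proof.
move=> fB; have fU : (f @ U) `[- B, B]%classic.
  by apply: nearW => k /=; rewrite in_itv/= -ler_norml.
have [l [/= lB lc]] := @segment_compact R (- B) B (f @ U) (fmap_proper_filter f _) fU.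
exists l; last by rewrite ler_norml; move: lB; rewrite in_itv.
move=> A lA; have [//|nA] := in_ultra_setVsetC (f @^-1` A) UU.
by have [x [nAx Ax]] := lc (~` A) A nA lA.
Qed.

Lemma escaping_mass_exists (x : nat -> X) (B : R) : (forall k, `|x k| <= B) ->
  exists beta, escaping_mass x beta.
Proof.
move=> xB; have pb m k : `|partial_sum m (x k)| <= C * C * B.
  apply: (le_trans (partial_sum_bound _ _)).
  by rewrite ler_wpM2l// mulr_ge0// ltW.
have [|a Ha] := @choice _ _ (fun i (l : R) => coef (x k) i @[k --> U] --> l).
  move=> i; have [|l fl _] := @ultra_bounded_cvg (fun k => coef (x k) i) (C * C * B + C * C *
    B).
    move=> k; have -> : coef (x k) i = partial_sum i.+1 (x k) - partial_sum i (x k).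
      by rewrite /partial_sum big_ord_recr/= addrAC subrr add0r.
    by rewrite (le_trans (ler_normB _ _))// lerD.
  by exists l.
have aB m : `|\sum_(i < m) a i| <= C * C * B.
  have h : partial_sum m (x k) @[k --> U] --> \sum_(i < m) a i.
    exact: (@cvg_ord_sum _ R^o _ U _ (fun i k => coef (x k) i)).
  by apply: (ler_cvg_to (cvg_norm h) (cvg_cst (C * C * B))); apply: nearW.
have [A hA _] := ultra_bounded_cvg aB.
have [|S hS _] := @ultra_bounded_cvg (fun k => total_sum (x k)) (C * C * B).
  move=> k; apply: (ler_cvg_to (cvg_norm (@cvg_total_sum (x k))) (cvg_cst (C * C * B))).
  exact: nearW.
by exists (S - A), a, A, S.
Qed.

Lemma escaping_mass_unique (x : nat -> X) b b' :
  escaping_mass x b -> escaping_mass x b' -> b = b'.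
Proof.
move=> [a [A [S [ha hA hS ->]]]] [a' [A' [S' [ha' hA' hS' ->]]]].
have -> : S = S' by exact: (norm_cvg_unique hS hS').
have aE : a = a' by apply/funext => i; exact: (norm_cvg_unique (ha i) (ha' i)).
by rewrite aE in hA; have -> : A = A' by exact: (norm_cvg_unique hA hA').
Qed.

Lemma escaping_mass_linear (x x' : nat -> X) b b' (s : R) :
  escaping_mass x b -> escaping_mass x' b' ->
  escaping_mass (fun k => s *: x k + x' k) (s * b + b').
Proof.
move=> [a [A [S [ha hA hS ->]]]] [a' [A' [S' [ha' hA' hS' ->]]]].
exists (fun i => s * a i + a' i), (s * A + A'), (s * S + S'); split.
- move=> i; under eq_fun do rewrite (hb_linear hb).
  by apply: cvgD => //; apply: cvgM => //; exact: cvg_cst.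
- under eq_fun do rewrite big_split -mulr_sumr/=.
  by apply: cvgD => //; apply: cvgM => //; exact: cvg_cst.
- under eq_fun do rewrite total_sum_linear.
  by apply: cvgD => //; apply: cvgM => //; exact: cvg_cst.
- by rewrite mulrBr opprD addrACA.
Qed.

End EscapingMass.

(** * The gliding hump *)

Section Structure.
Variables (R : realType) (X : completeNormedModType R) (E : normedModType R).
Variables (e : nat -> X) (z : nat -> E) (coef : X -> nat -> R) (C : R).
Hypothesis hb : homogeneous_basis e z coef C.
Variable U : set_system nat.
Hypothesis UU : UltraFilter U.
Hypothesis Uoo : \oo `<=` U.

Let C0 : 0 < C := hb_gt0 hb.

(** [k l] is taken so far along [U] that the first [p l] coordinates of [x (k l)] are close to their
    limits; then [p l.+1] is taken so large that [x (k l)] almost ends before it. *)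
Lemma selection (x : nat -> X) (a : nat -> R) (A S : R) (eps : nat -> R) :
  (forall i, coef (x k) i @[k --> U] --> a i) ->
  \sum_(i < m) a i @[m --> U] --> A ->
  total_sum coef (x k) @[k --> U] --> S ->
  (forall l, 0 < eps l) ->
  exists p k : nat -> nat, [/\ strictly_increasing p, strictly_increasing k &
    forall l, [/\
      `|lincomb e (p l) (coef (x (k l))) - lincomb e (p l) a| <= eps l,
      `|x (k l) - lincomb e (p l.+1) (coef (x (k l)))| <= eps l,
      `|\sum_(i < p l) a i - A| <= eps l &
      `|total_sum coef (x (k l)) - S| <= eps l]].
Proof.
move=> ha hA hS eps0.
have near_gt n : U [set k | (n < k)%N] by apply: Uoo; exists n.+1.
have /choice[kf Hkf] : forall lpk : nat * nat * nat, exists k, [/\ (lpk.2 < k)%N,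
    `|lincomb e lpk.1.2 (coef (x k)) - lincomb e lpk.1.2 a| <= eps lpk.1.1 &
    `|total_sum coef (x k) - S| <= eps lpk.1.1].
  move=> [[l p] k0] /=.
  have h1 : lincomb e p (coef (x k)) @[k --> U] --> lincomb e p a.
    apply: (@cvg_ord_sum R X nat U _ (fun i k => coef (x k) i *: e i) (fun i => a i *: e i) p)
      => i.
    by apply: cvgZ; [exact: ha | exact: cvg_cst].
  have /cvgrPdist_le/(_ _ (eps0 l)) h1' := h1.
  have /cvgrPdist_le/(_ _ (eps0 l)) h2' := hS.
  have [k [[k1 k2] k3]] := @filter_ex _ U _ _ (filterI (filterI h1' h2') (near_gt k0)).
  by exists k; split; rewrite // distrC.
have /choice[pf Hpf] : forall lkp : nat * nat * nat, exists p, [/\ (lkp.2 < p)%N,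
    `|x lkp.1.2 - lincomb e p (coef (x lkp.1.2))| <= eps lkp.1.1 &
    `|\sum_(i < p) a i - A| <= eps lkp.1.1.+1].
  move=> [[l k] p0] /=.
  have /cvgrPdist_le/(_ _ (eps0 l))/Uoo h1 := @hb_cvg _ _ _ _ _ _ _ hb (x k).
  have /cvgrPdist_le/(_ _ (eps0 l.+1)) h2 := hA.
  have [p [[p1 p2] p3]] := @filter_ex _ U _ _ (filterI (filterI h1 h2) (near_gt p0)).
  by exists p; split; rewrite // distrC.
have [p0 hp0] : exists p, `|\sum_(i < p) a i - A| <= eps 0%N.
  have /cvgrPdist_le/(_ _ (eps0 0%N)) h2 := hA.
  by have [p hp] := @filter_ex _ U _ _ h2; exists p; rewrite distrC.
(* The state is the pair of [p l] and [k l]: the new [p] depends on the old [k], the new [k] on the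
   new [p]. The value of [pf] at stage [l] becomes [p l.+1], which is why it meets the tolerance
   [eps l.+1] for the sums of [a]. *)
pose fix st l : nat * nat := if l is l'.+1 then
    let p := pf (l', (st l').2, (st l').1) in (p, kf (l, p, (st l').2))
  else (p0, kf (0%N, p0, 0%N)).
exists (fun l => (st l).1), (fun l => (st l).2); split.
- apply: homo_ltn => [? ? ?|l]; first exact: ltn_trans.
  by have [] := Hpf (l, (st l).2, (st l).1).
- apply: homo_ltn => [? ? ?|l]; first exact: ltn_trans.
  by have [] := Hkf (l.+1, (st l.+1).1, (st l).2).
move=> l; have [_ h2 _] := Hpf (l, (st l).2, (st l).1).
have [h1 h4] : `|lincomb e (st l).1 (coef (x (st l).2)) - lincomb e (st l).1 a| <= eps l /\
    `|total_sum coef (x (st l).2) - S| <= eps l.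
  case: l {h2} => [|l]; first by have [] := Hkf (0%N, p0, 0%N).
  by have [] := Hkf (l.+1, (st l.+1).1, (st l).2).
split=> //; case: l {h1 h2 h4} => [//|l].
by have [] := Hpf (l, (st l).2, (st l).1).
Qed.

(** On its block, [alpha] is the limit sequence [a] and [b] the coordinates of [x (k l)], each
    corrected at the first index of the block so that the sum is exactly 0 or beta. The corrections
    are small because partial sums of [a] are close to [A] and total sums close to [S]. Summation by
    parts puts tail sums of [c] in front of the alpha blocks. *)
Lemma escaping_mass_structure (x : nat -> X) (beta eta : R) :
  escaping_mass coef U x beta -> 0 < eta ->
  exists (p k kappa : nat -> nat) (a alpha b : nat -> R),
  [/\ strictly_increasing p, strictly_increasing k,
      {homo kappa : i j / (i <= j)%N},
      forall l i, (p l <= i < p l.+1)%N -> kappa i = l &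
      forall i, (i < p 0)%N -> kappa i = 0%N] /\
  [/\ forall j, \sum_(p j <= i < p j.+1) alpha i = 0,
      forall j, \sum_(p j <= i < p j.+1) b i = beta &
      forall n (c : nat -> R) M,
      (forall j, `|\sum_(l < n | (j <= l)%N) c l| <= M) ->
      `|\sum_(l < n) c l *: x (k l) -
        ((\sum_(l < n) c l) *: lincomb e (p 0) a +
         \sum_(j < n) ((\sum_(l < n | (j < l)%N) c l) *:
                         \sum_(p j <= i < p j.+1) alpha i *: e i +
                       c j *: \sum_(p j <= i < p j.+1) b i *: e i))| <= eta * M].
Proof.
move=> [a [A [S [ha hA hS ->]]]] eta0.
(* The error on block j will be at most [G * M * eps j], and the geometric series then sums to at
   most [eta * M]. *)
pose G := 4 * C + 2 * (2 * C * C + 2 * C + 2).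
have G0 : 0 < G by rewrite !(addr_gt0, mulr_gt0).
pose eps l : R := eta / (2 * G) * 2^-1 ^+ l.
have eps0 l : 0 < eps l by rewrite mulr_gt0 ?exprn_gt0 ?invr_gt0// divr_gt0// mulr_gt0.
have epsS l : eps l.+1 <= eps l.
  rewrite /eps exprS; apply: ler_wpM2l; first by rewrite ltW// divr_gt0// mulr_gt0.
  by rewrite ler_piMl ?exprn_ge0 ?invr_ge0// invf_le1// ler1n.
have [p [k [ps ks H]]] := selection ha hA hS eps0.
have [kappa [km kE k0]] := block_index ps.
have pm : {homo p : i j / (i <= j)%N}.
  by apply: homo_leq => [//|? ? ?|i]; [exact: leq_trans | exact/ltnW/ps].
pose As m := \sum_(i < m) a i.
pose gamma j := As (p j.+1) - As (p j).
pose y l := x (k l).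
pose theta l := partial_sum coef (p l.+1) (y l) - partial_sum coef (p l) (y l) - (S - A).
pose alpha i := a i - (if i == p (kappa i) then gamma (kappa i) else 0).
pose b i := coef (y (kappa i)) i - (if i == p (kappa i) then theta (kappa i) else 0).
have blk (V : lmodType R) (v : nat -> V) (f g : nat -> nat -> R) j :
    \sum_(p j <= i < p j.+1) (f (kappa i) i - (if i == p (kappa i) then g (kappa i) i else 0))
      *: v i =
    \sum_(p j <= i < p j.+1) f j i *: v i - g j (p j) *: v (p j).
  rewrite (eq_big_nat _ _ (F2 := fun i => f j i *: v i - (if i == p j then g j i else 0) *: v
    i)).
    rewrite sumrB; congr (_ - _); rewrite big_ltn ?ps// eqxx big_nat big1 ?addr0//.
    by move=> i /andP[pi _]; rewrite gtn_eqF// scale0r.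
  by move=> i pi; rewrite (kE _ _ pi) scalerBl.
have split2 (W : zmodType) (F : nat -> W) j :
    \sum_(p j <= i < p j.+1) F i = \sum_(i < p j.+1) F i - \sum_(i < p j) F i.
  rewrite -[in RHS](big_mkord xpredT F) -[X in _ - X](big_mkord xpredT F).
  by rewrite (@big_cat_nat _ _ _ (p j) 0 (p j.+1))/= ?pm// addrAC subrr add0r.
exists p, k, kappa, a, alpha, b; split=> //.
have oneE (I : seq nat) (f : nat -> R) : \sum_(i <- I) f i = \sum_(i <- I) f i *: (1 : R^o).
  by apply: eq_bigr => i _; rewrite /GRing.scale/= mulr1.
split.
- move=> j; rewrite oneE (blk R^o (fun=> 1) (fun _ i => a i) (fun j _ => gamma j)) -oneE.
  by rewrite split2 /gamma /As /GRing.scale/= mulr1 subrr.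
- move=> j; rewrite oneE (blk R^o (fun=> 1) (fun j i => coef (y j) i) (fun j _ => theta j))
  -oneE.
  by rewrite split2 /theta /partial_sum /GRing.scale/= mulr1 opprB addrC subrK.
move=> n c M tM.
set AA := fun j => \sum_(p j <= i < p j.+1) alpha i *: e i.
set BB := fun j => \sum_(p j <= i < p j.+1) b i *: e i.
pose rest l := y l - lincomb e (p l) a - \sum_(p l <= i < p l.+1) coef (y l) i *: e i.
have AE j : lincomb e (p j.+1) a - lincomb e (p j) a = AA j + gamma j *: e (p j).
  rewrite /AA (blk X e (fun _ i => a i) (fun j _ => gamma j))/= subrK split2.
  by [].
have BE l : y l = lincomb e (p l) a + (BB l + (theta l *: e (p l) + rest l)).
  rewrite /BB (blk X e (fun j i => coef (y j) i) (fun j _ => theta j))/=.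
  by rewrite [_ - _ + (_ + _)]addrA subrK /rest addrCA [lincomb _ _ _ + _]addrA !subrKC.
have VE l : lincomb e (p l) a = lincomb e (p 0%N) a + \sum_(j < l) (AA j + gamma j *: e (p j)).
  elim: l => [|l IH]; first by rewrite big_ord0 addr0.
  by rewrite big_ord_recr/= addrA -IH -AE addrC subrK.
(* After substituting [BE] and [VE] and summing by parts, only the corrections [gamma], [theta] and
   the remainders survive. *)
have err : \sum_(l < n) c l *: x (k l) - ((\sum_(l < n) c l) *: lincomb e (p 0%N) a +
     \sum_(j < n) ((\sum_(l < n | (j < l)%N) c l) *: AA j + c j *: BB j)) =
   \sum_(j < n) ((\sum_(l < n | (j < l)%N) c l) *: (gamma j *: e (p j)) +
     c j *: (theta j *: e (p j) + rest j)).
  have -> : \sum_(l < n) c l *: x (k l) = (\sum_(l < n) c l) *: lincomb e (p 0%N) a +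
      \sum_(j < n) (\sum_(l < n | (j < l)%N) c l) *: (AA j + gamma j *: e (p j)) +
      \sum_(j < n) c j *: (BB j + (theta j *: e (p j) + rest j)).
    rewrite scaler_suml -(tail_exchange n c (fun j => AA j + gamma j *: e (p j)))
      -!big_split/=; apply: eq_bigr => l _.
    by rewrite -!scalerDr -VE -BE.
  set V := _ *: lincomb e _ a; rewrite -(addrA V) opprD addrACA subrr add0r.
  rewrite -big_split/= -sumrB; apply: eq_bigr => j _.
  rewrite [_ *: (AA j + _)]scalerDr [c j *: (BB j + _)]scalerDr.
  by rewrite addrACA [LHS]addrC addKr.
rewrite err.
have M0 : 0 <= M by apply: le_trans (tM 0%N).
(* A coefficient is the difference of two consecutive tails. *)
have c2M l : (l < n)%N -> `|c l| <= 2 * M.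
  move=> ln; rewrite -[c l](addrK (\sum_(i < n | (l < i)%N) c i)) -tail_sum_rec//.
  by rewrite (le_trans (ler_normB _ _))// mulr2n mulrDl mul1r lerD.
have gE j : `|gamma j| <= 2 * eps j.
  have [_ _ h1 _] := H j; have [_ _ h2 _] := H j.+1.
  rewrite /gamma -(subrKA A) (le_trans (ler_normD _ _))// mulr2n mulrDl mul1r lerD//.
    exact: le_trans (epsS j).
  by rewrite distrC.
have tE l : `|theta l| <= (2 * C + 2) * eps l.
  have [h1 h2 h3 h4] := H l.
  have h5 : `|total_sum coef (y l) - partial_sum coef (p l.+1) (y l)| <= C * eps l.
    by apply: (le_trans (total_sum_dist hb _ _)); rewrite ler_wpM2l// ltW.
  have h6 : `|partial_sum coef (p l) (y l) - As (p l)| <= C * eps l.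
    by apply: (le_trans (sum_diff_le hb _ _ _ _)); rewrite ler_wpM2l// ltW.
  have -> : theta l = - (total_sum coef (y l) - partial_sum coef (p l.+1) (y l))
     - (partial_sum coef (p l) (y l) - As (p l)) + (total_sum coef (y l) - S) -
     (As (p l) - A) by rewrite /theta; ring.
  apply: (le_trans (ler_normB _ _)); apply: (le_trans (lerD (ler_normD _ _) (lexx _))).
  apply: (le_trans (lerD (lerD (ler_normB _ _) (lexx _)) (lexx _))).
  rewrite normrN (_ : _ * eps l = C * eps l + C * eps l + eps l + eps l); last by ring.
  by rewrite !lerD.
have rE l : `|rest l| <= 2 * eps l.
  have [h1 h2 h3 h4] := H l.
  have -> : rest l = (y l - lincomb e (p l.+1) (coef (y l))) +
     (lincomb e (p l) (coef (y l)) - lincomb e (p l) a).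
    by rewrite /rest split2 -!/(lincomb _ _ _) opprB addrACA [RHS]addrACA; congr (_ + _);
      rewrite addrC.
  by rewrite (le_trans (ler_normD _ _))// mulr2n mulrDl mul1r lerD.
apply: (le_trans (ler_norm_sum _ _ _)).
apply: (@le_trans _ _ (\sum_(j < n) G * M * eps j)).
  apply: ler_sum => j _; apply: (le_trans (ler_normD _ _)); rewrite !normrZ.
  have eC := hb_norm hb (p j).
  have h1 : `|\sum_(l < n | (j < l)%N) c l| * (`|gamma j| * `|e (p j)|) <= M * (2 * eps j * C).
    apply: ler_pM; [by [] | exact: mulr_ge0 | exact: (tM j.+1) | exact: ler_pM].
  have h2 : `|theta j *: e (p j) + rest j| <= (2 * C + 2) * eps j * C + 2 * eps j.
    by rewrite (le_trans (ler_normD _ _))// lerD// normrZ ler_pM.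
  have h3 : `|c j| * `|theta j *: e (p j) + rest j| <= 2 * M * ((2 * C + 2) * eps j * C + 2 *
    eps j).
    by rewrite ler_pM// c2M.
  apply: (le_trans (lerD h1 h3)).
  have : 0 <= C * M * eps j.
    by apply: mulr_ge0 (ltW (eps0 j)); apply: mulr_ge0 (ltW C0) M0.
  by rewrite /G; lra.
rewrite -mulr_sumr /eps -mulr_sumr.
apply: (@le_trans _ _ (G * M * (eta / (2 * G) * 2))).
  rewrite ler_wpM2l ?mulr_ge0 ?(ltW G0)// ler_wpM2l ?sum_half_le2//.
  by rewrite ltW// divr_gt0// mulr_gt0.
rewrite le_eqVlt; apply/orP; left; apply/eqP; field.
by rewrite gt_eqF.
Qed.

End Structure.

(** * Complemented copies *)

Section CollapseOperator.
Variables (R : realType) (X E : completeNormedModType R).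
Variables (e : nat -> X) (z : nat -> E) (coef : X -> nat -> R) (C : R).
Hypothesis hb : homogeneous_basis e z coef C.

Let C0 : 0 < C := hb_gt0 hb.

Lemma closed_span_basis x : closed_span e x.
Proof.
apply/closed_spanP => d d0; have /cvgrPdist_lt/(_ d d0)[m _ Hm] := @hb_cvg _ _ _ _ _ _ _ hb x.
by exists m, (coef x); apply: (Hm m); rewrite /=.
Qed.

Lemma sum_below_le n (a : nat -> R) p :
  `|\sum_(i < n | (i < p)%N) a i| <= C * C * `|lincomb e n a|.
Proof.
apply: le_trans (partial_sum_bound hb p _).
have -> // : \sum_(i < n | (i < p)%N) a i = partial_sum coef p (lincomb e n a).
rewrite /partial_sum; under [RHS]eq_bigr do rewrite (hb_coef hb).
rewrite -[RHS]big_mkcond/=.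
rewrite (@big_ord_widen_cond _ _ _ n (maxn n p) (fun i => i < p)%N a) ?leq_maxl//.
rewrite (@big_ord_widen_cond _ _ _ p (maxn n p) (fun i => i < n)%N a) ?leq_maxr//.
by apply: eq_bigl => i; rewrite andbC.
Qed.

Definition collapse_bound : R := C + C * C * `|z 0|.

(** From e_i -> z_(kappa i) one subtracts the rank-one map sending x to the sum of its first [p]
    coordinates times [z 0]. If [kappa] vanishes below [p], the result annihilates the first [p]
    basis vectors, and so the constant part V. The second term of [collapse_bound] accounts for the
    rank-one map. *)
Lemma collapse_operator (kappa : nat -> nat) (p : nat) :
  {homo kappa : i j / (i <= j)%N} ->
  exists S : X -> E, [/\ forall (a : R) x y, S (a *: x + y) = a *: S x + S y,
    forall x, `|S x| <= collapse_bound * `|x|, forall x, closed_span z (S x) &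
    forall i, S (e i) = z (kappa i) - (if (i < p)%N then z 0 else 0)].
Proof.
move=> km; pose r i := z (kappa i) - (if (i < p)%N then z 0%N else 0).
have rE n (a : nat -> R) : lincomb r n a =
    \sum_(i < n) a i *: z (kappa i) - (\sum_(i < n | (i < p)%N) a i) *: z 0%N.
  rewrite scaler_suml [X in _ - X]big_mkcond -sumrB; apply: eq_bigr => i _.
  by rewrite /r scalerBr; case: ifP; rewrite ?scaler0.
have cb0 : 0 <= collapse_bound.
  by apply: addr_ge0 (ltW C0) _; do 2![apply: mulr_ge0 => //]; exact: ltW.
have [|S [Slin Sb SE Scl]] := @linear_extension R X E e r collapse_bound cb0.
  move=> n a; rewrite rE (le_trans (ler_normB _ _))// /collapse_bound mulrDl lerD//.
    exact: (hb_reindex hb).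
  by rewrite normrZ mulrAC ler_wpM2r// sum_below_le.
exists S; split.
- by move=> a x y; apply: Slin; exact: closed_span_basis.
- by move=> x; apply: Sb; exact: closed_span_basis.
- move=> x; apply: (@closed_span_sub _ _ r); last exact/Scl/closed_span_basis.
    exact: closed_span_subspace.
  move=> i; have [_ Z0 ZD] := (closed_submodP _).1 (closed_span_subspace z).
  rewrite /r addrC -scaleN1r; apply: ZD; last exact: closed_span_mem.
  by case: ifP => // _; exact: closed_span_mem.
- by move=> i; rewrite -[e i]lincomb_delta SE lincomb_delta.
Qed.

Lemma spread_subsequence_le (x : nat -> X) (D : R) (k : nat -> nat) :
  strictly_increasing k ->
  (forall n a, `|lincomb x n a| <= D * `|lincomb z n a|) ->
  forall n (c : nat -> R), `|\sum_(l < n) c l *: x (k l)| <= D * `|lincomb z n c|.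
Proof.
move=> ks xz n c; have kb i : (i < n)%N -> (k i < (\max_(j < n) k j).+1)%N.
  by move=> ni; rewrite ltnS (leq_bigmax (Ordinal ni)).
rewrite (lincomb_reindex _ _ kb); apply: (le_trans (xz _ _)).
by rewrite -(lincomb_reindex z c kb) (hb_spreading hb ks).
Qed.

Variable U : set_system nat.
Hypothesis UU : UltraFilter U.
Hypothesis Uoo : \oo `<=` U.

(** The operator S annihilates V and the zero-sum blocks and maps the l-th [b] block to beta z_l.
    With T z_l = x_(k l) / beta, the structure estimate puts S T within one half of the identity on
    Z. *)
Lemma escaping_mass_copy (Y : set X) (x : nat -> X) (beta D : R) :
  closed_subspace Y -> (forall k, Y (x k)) -> 0 < D ->
  (forall n a, `|lincomb x n a| <= D * `|lincomb z n a|) ->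
  escaping_mass coef U x beta -> beta != 0 ->
  contains_complemented_copy Y (closed_span z).
Proof.
move=> sY Yx D0 xz xb b0.
have cb0 : 0 < collapse_bound.
  by apply: ltr_pwDl C0 _; do 2![apply: mulr_ge0 => //]; exact: ltW.
have nb : 0 < `|beta| by rewrite normr_gt0.
(* On finite combinations the error of S T is at most [collapse_bound * eta * C / |beta|], here
   equal to 1/2. *)
pose eta := `|beta| / (2 * collapse_bound * C).
have eta0 : 0 < eta by rewrite divr_gt0// !mulr_gt0.
have [p [k [kappa [a [alpha [b [[ps ks km kE k0] [al0 bb est]]]]]]]] :=
  escaping_mass_structure hb UU Uoo xb eta0.
have [S [Slin Sb SZ Se]] := @collapse_operator kappa (p 0%N) km.
have pm : {homo p : i j / (i <= j)%N}.
  by apply: homo_leq => [//|? ? ?|i]; [exact: leq_trans | exact/ltnW/ps].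
have S0 : S 0 = 0 by have := Slin (-1) 0 0; rewrite scaler0 addr0 scaleN1r addNr.
have SZr (c : R) u : S (c *: u) = c *: S u by have := Slin c u 0; rewrite S0 !addr0.
have SD u v : S (u + v) = S u + S v by have := Slin 1 u v; rewrite !scale1r.
have SB u v : S (u - v) = S u - S v by rewrite SD -scaleN1r SZr scaleN1r.
have Ssum (I : Type) (s : seq I) (f : I -> X) : S (\sum_(i <- s) f i) = \sum_(i <- s) S (f i).
  by elim/big_ind2: _ => // [u ? v ? <- <-]; exact: SD.
have Sblk j (f : nat -> R) : S (\sum_(p j <= i < p j.+1) f i *: e i) =
    (\sum_(p j <= i < p j.+1) f i) *: z j.
  rewrite Ssum scaler_suml; apply: eq_big_nat => i pi; rewrite SZr Se (kE _ _ pi).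
  have /andP[pji _] := pi; have := pm 0%N j (leq0n j).
  by move=> /leq_trans/(_ pji); rewrite ltnNge => ->; rewrite subr0.
pose y l := beta^-1 *: x (k l).
have yE n c : lincomb y n c = beta^-1 *: \sum_(l < n) c l *: x (k l).
  by rewrite scaler_sumr; apply: eq_bigr => l _; rewrite /y !scalerA mulrC.
pose Ct := `|beta|^-1 * D.
have Ct0 : 0 < Ct by rewrite mulr_gt0// invr_gt0.
have [|T [Tlin Tb TE Tcl]] := @linear_extension R E X z y Ct (ltW Ct0).
  move=> n c; rewrite yE normrZ normfV -mulrA ler_wpM2l ?invr_ge0//.
  exact: (spread_subsequence_le ks xz).
have fin n c : `|S (lincomb y n c) - lincomb z n c| <= 2^-1 * `|lincomb z n c|.
  have := est n c (C * `|lincomb z n c|) (hb_tail hb n c).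
  set main := (X in `|_ - X|) => h.
  have Smain : S main = beta *: lincomb z n c.
    rewrite /main SD SZr (_ : S (lincomb e _ a) = 0) ?scaler0 ?add0r; last first.
      rewrite /lincomb Ssum big1// => i _.
      by rewrite SZr Se k0// ltn_ord subrr scaler0.
    rewrite Ssum /lincomb scaler_sumr; apply: eq_bigr => j _.
    by rewrite Slin SZr !Sblk al0 bb scale0r scaler0 add0r !scalerA mulrC.
  have -> : S (lincomb y n c) - lincomb z n c =
      beta^-1 *: S ((\sum_(l < n) c l *: x (k l)) - main).
    by rewrite yE SZr SB scalerBr Smain scalerA mulVf// scale1r.
  rewrite normrZ normfV mulrC ler_pdivrMr//; apply: (le_trans (Sb _)).
  apply: (le_trans (ler_wpM2l (ltW cb0) h)).
  rewrite le_eqVlt; apply/orP; left; apply/eqP; rewrite /eta; field.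
  by rewrite !gt_eqF.
have sZ := closed_span_subspace z.
have [_ _ ZD] := (closed_submodP _).1 sZ.
have ZB u v : closed_span z u -> closed_span z v -> closed_span z (u - v).
  by move=> Zu Zv; rewrite addrC -scaleN1r; exact: ZD.
apply: (complemented_copy_criterion sZ Slin cb0 Sb SZ Tlin Ct0 Tb).
  move=> u Zu; apply: (closed_span_sub sY _ (Tcl u Zu)) => l.
  have [_ Y0 YD] := (closed_submodP Y).1 sY.
  by have := YD beta^-1 _ _ (Yx (k l)) Y0; rewrite addr0.
move=> u Zu; apply/ler_addgt0Pr => d d0.
(* Replacing [u] by a combination at distance below [d / G] changes the estimate by at most [d]. *)
pose G := 2^-1 + (collapse_bound * Ct + 1).
have G0 : 0 < G by rewrite !addr_gt0 ?mulr_gt0 ?invr_gt0.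
have [n [c uc]] := (closed_spanP z u).1 Zu (d / G) (divr_gt0 d0 G0).
set v := lincomb z n c in uc.
have Zv : closed_span z v by exact: closed_span_lincomb.
have hv : `|S (T v) - v| <= 2^-1 * `|v| by rewrite /v TE; exact: fin.
have h1 : `|v| <= `|u| + `|u - v| by rewrite -{1}(subKr u v) ler_normB.
have h2 : `|S (T (u - v))| <= collapse_bound * Ct * `|u - v|.
  by rewrite (le_trans (Sb _))// -mulrA ler_wpM2l ?(ltW cb0)// Tb//; exact: ZB.
have -> : S (T u) - u = (S (T v) - v) + (S (T (u - v)) - (u - v)).
  by rewrite (linear_onB Tlin)// SB addrACA subrKC -opprD subrKC.
have h3 : G * `|u - v| <= d by rewrite mulrC -ler_pdivlMr// ltW.
apply: (le_trans (ler_normD _ _)).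
apply: (le_trans (lerD hv (ler_normB _ _))).
move: h1 h2 h3; rewrite /G; move: (collapse_bound * Ct) => K; nra.
Qed.

End CollapseOperator.

(** * Incomparability *)

Lemma big_mul (V : nmodType) n m (F : nat -> V) :
  \sum_(t < n * m) F t = \sum_(i < n) \sum_(l < m) F (i * m + l)%N.
Proof.
rewrite -(big_mkord xpredT F) big_nat_mul big_mkord; apply: eq_bigr => i _.
rewrite -{1}[(i * m)%N]add0n big_addn -mulnBl subSnn mul1n big_mkord.
by apply: eq_bigr => l _; rewrite addnC.
Qed.

(** [kappa] also gives a block number to the indices below [p 0]; the test removes them. *)
Lemma block_restrict (W : nmodType) (p kappa : nat -> nat) n (P : pred nat) (F : nat -> W) :
  {homo p : i j / (i <= j)%N} ->
  (forall l i, (p l <= i < p l.+1)%N -> kappa i = l) ->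
  \sum_(i < p n | P (kappa i)) (if (p 0 <= i)%N then F i else 0) =
  \sum_(j < n | P j) \sum_(p j <= i < p j.+1) F i.
Proof.
move=> pm kE; rewrite -(big_mkord (fun i => P (kappa i)) (fun i => if (p 0 <= i)%N then F i
  else 0)).
rewrite big_mkcond/= (@big_cat_nat _ _ _ (p 0%N) 0 (p n))//=; last exact: pm.
rewrite big_nat big1 ?add0r; last first.
  by move=> i /andP[_ i0]; rewrite leqNgt i0; case: ifP.
rewrite big_blocks// [RHS]big_mkcond/=; apply: eq_bigr => j _.
rewrite (eq_big_nat _ _ (F2 := fun i => if P j then F i else 0)); last first.
  move=> i pi; rewrite (kE _ _ pi); case/andP: pi => pji _.
  by rewrite (leq_trans _ pji)// pm.
by case: ifP => // _; rewrite big1.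
Qed.

Section Incomparability.
Variables (R : realType) (X E : completeNormedModType R).
Variables (e : nat -> X) (z : nat -> E) (coef : X -> nat -> R) (C : R).
Hypothesis hb : homogeneous_basis e z coef C.

Let C0 : 0 < C := hb_gt0 hb.

(** Blocks of sum zero can be suppressed at the cost of [C], and suppression extends to bounded
    multipliers at the cost of a factor 2. *)
Lemma block_multipliers (p kappa : nat -> nat) (g : nat -> R) n (c d : nat -> R) (m : R) :
  {homo p : i j / (i <= j)%N} -> {homo kappa : i j / (i <= j)%N} ->
  (forall l i, (p l <= i < p l.+1)%N -> kappa i = l) ->
  (forall j, \sum_(p j <= i < p j.+1) g i = 0) ->
  0 <= m -> (forall j, `|d j| <= m) ->
  `|\sum_(j < n) (d j * c j) *: \sum_(p j <= i < p j.+1) g i *: e i| <=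
  2 * (C * `|\sum_(j < n) c j *: \sum_(p j <= i < p j.+1) g i *: e i|) * m.
Proof.
move=> pm km kE g0 m0 dm.
under eq_bigr do rewrite -scalerA.
apply: (sn_multipliers (norm_seminorm X) (n := n)
  (v := fun j => c j *: \sum_(p j <= i < p j.+1) g i *: e i)) => // D.
pose f i := if (p 0 <= i)%N then c (kappa i) * g i else 0.
have fE (P : pred nat) : \sum_(j < n | P j) c j *: (\sum_(p j <= i < p j.+1) g i *: e i) =
    \sum_(i < p n | P (kappa i)) f i *: e i.
  rewrite (eq_bigr (fun i : 'I_(p n) => if (p 0 <= i)%N then (c (kappa i) * g i) *: e i else
    0)).
    rewrite (@block_restrict _ p kappa n P (fun i => (c (kappa i) * g i) *: e i))//.
    apply: eq_bigr => j _; rewrite scaler_sumr; apply: eq_big_nat => i pi.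
    by rewrite scalerA (kE _ _ pi).
  by move=> i _; rewrite /f; case: ifP => // _; rewrite scale0r.
rewrite fE (fE xpredT).
rewrite (eq_bigl (fun i : 'I_(p n) => ~~ predC D (kappa i))); last by move=> i /=;
  rewrite negbK.
apply: (hb_zero_sum hb km) => k _.
rewrite (@block_restrict _ p kappa n (eq_op^~ k) (fun i => c (kappa i) * g i))// big1// => j _.
rewrite (eq_big_nat _ _ (F2 := fun i => c j * g i)); last by move=> i pi; rewrite (kE _ _ pi).
by rewrite -mulr_sumr g0 mulr0.
Qed.

(** The summing basis norm of the coefficients [c], which is the supremum of the tail sums, is at
    most [M]. *)
Definition tails_le n (c : nat -> R) (M : R) : Prop :=
  forall j, `|\sum_(l < n | (j <= l)%N) c l| <= M.

(* Spreading a vector of the z-span that is small relative to its l1-norm and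
   taking absolute values yields convex blocks on which the zero-sum part is
   negligible; on them only the tail sums survive. *)
Lemma summing_of_decomposition (x B : nat -> X) (D K L : R) :
  0 < D -> 0 < K -> 0 < L ->
  (forall n c, `|lincomb z n c| <= D * `|lincomb x n c|) ->
  (forall n c, `|lincomb x n c| <= D * `|lincomb z n c|) ->
  (forall n c M, tails_le n c M -> `|lincomb x n c - lincomb B n c| <= K * M) ->
  (forall n c, `|lincomb B n (fun j => `|c j|)| <= L * `|lincomb B n c|) ->
  forall n d M, tails_le n d M -> `|lincomb z n d| <= D * K * M.
Proof.
move=> D0 K0 L0 zx xz xB BL n d M dM.
pose T := \sum_(i < n) `|d i|; have T0 : 0 <= T by exact: sumr_ge0.
(* [G * dl] will bound every convex block of [B]: [D] comes from [x], [K * C] from the tail sums,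
   and [L] from taking absolute values. *)
pose G := L * (D + K * C); have G0 : 0 < G by rewrite mulr_gt0// addr_gt0// mulr_gt0.
apply/ler_addgt0Pr => eps eps0.
(* Makes the final error [D * (T * (G * dl))] at most [eps]; the summand 1 covers [T = 0]. *)
pose dl := eps / (D * (T * G) + 1).
have den : 0 < D * (T * G) + 1.
  by rewrite ltr_wpDl//; apply: mulr_ge0 (ltW D0) _; exact: mulr_ge0 T0 (ltW G0).
have dl0 : 0 < dl by exact: divr_gt0.
have [m [c [c1 cd]]] := hb_not_l1 hb dl0.
have small s : `|\sum_(l < m) `|c l| *: B (s + l)%N| <= G * dl.
  pose c' l := if (l < s)%N then 0 else c (l - s)%N.
  have cE (V : lmodType R) (v : nat -> V) (h : R -> R) : h 0 = 0 ->
      \sum_(l < s + m) h (c' l) *: v l = \sum_(l < m) h (c l) *: v (s + l)%N.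
    move=> h0; rewrite big_split_ord/= big1 ?add0r => [|l _]; last first.
      by rewrite /c' ltn_ord h0 scale0r.
    by apply: eq_bigr => l _; rewrite /c' ltnNge leq_addr/= addKn.
  rewrite -(cE X B (fun r => `|r|) (normr0 _)).
  apply: (le_trans (BL (s + m)%N c')).
  have zc : `|lincomb z (s + m) c'| <= dl.
    rewrite /lincomb (cE E z id erefl).
    by rewrite (one_spreading_fin (hb_spreading hb) (f := fun l => (s + l)%N))// => i _;
      rewrite ltn_add2l.
  have tc : tails_le (s + m) c' (C * dl).
    by move=> j; apply: (le_trans (hb_tail hb _ _ _)); rewrite ler_wpM2l// ltW.
  rewrite /G -mulrA ler_wpM2l ?(ltW L0)//.
  have -> : lincomb B (s + m) c' = lincomb x (s + m) c' - (lincomb x (s + m) c' - lincomb B (s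
    + m) c').
    by rewrite subKr.
  rewrite (le_trans (ler_normB _ _))// mulrDl lerD//.
    by apply: (le_trans (xz _ _)); rewrite ler_wpM2l// ltW.
  by rewrite -mulrA; exact: xB.
have m0 : (0 < m)%N.
  by case: m c1 {cd small} => [|//]; rewrite big_ord0 => /eqP; rewrite eq_sym oner_eq0.
(* Each [d i] is distributed over a block of length [m] with the convex weights [|c l|]. *)
pose g t := d (t %/ m)%N * `|c (t %% m)%N|.
have gE i l : (l < m)%N -> g (i * m + l)%N = d i * `|c l|.
  by move=> lm; rewrite /g divnMDl// divn_small// addn0 modnMDl modn_small.
have gsum (V : lmodType R) (v : nat -> V) : lincomb v (n * m) g =
    \sum_(i < n) d i *: \sum_(l < m) `|c l| *: v (i * m + l)%N.
  rewrite /lincomb (big_mul n m (fun t => g t *: v t)); apply: eq_bigr => i _.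
  by rewrite scaler_sumr; apply: eq_bigr => l _; rewrite gE// scalerA.
(* For a fixed offset [l] the [i] with [j <= i * m + l] form a tail, beginning at the ceiling of (j
   - l) / m; the weights average the corresponding tail sums of [d]. *)
have gM : tails_le (n * m) g M.
  move=> j; rewrite big_mkcond/= (big_mul n m (fun t => if (j <= t)%N then g t else 0)).
  rewrite exchange_big/=.
  apply: (le_trans (ler_norm_sum _ _ _)); rewrite -(mul1r M) -c1 mulr_suml.
  apply: ler_sum => l _.
  rewrite (eq_bigr (fun i : 'I_n => `|c l| * (if ((j - l + m.-1) %/ m <= i)%N then d i else
    0))).
    rewrite -mulr_sumr normrM normr_id ler_wpM2l// -big_mkcond/=; exact: dM.
  move=> i _; rewrite gE// -[((_ %/ _) <= i)%N]ltnS ltn_divLR// mulrC.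
  rewrite (_ : (j - l + m.-1 < i.+1 * m)%N = (j <= i * m + l)%N); last by apply/idP/idP; lia.
  by case: ifP; rewrite ?mulr0.
(* Collapsing each block to one index undoes the distribution. *)
have low : `|lincomb z n d| <= `|lincomb z (n * m) g|.
  have := @hb_z_reindex _ _ _ _ _ _ _ hb (n * m)%N g (fun t => (t %/ m)%N) (leq_div2r m).
  have -> // : \sum_(t < n * m) g t *: z (t %/ m)%N = lincomb z n d.
  rewrite (big_mul n m (fun t => g t *: z (t %/ m)%N)); apply: eq_bigr => i _.
  rewrite (eq_bigr (fun l : 'I_m => (d i * `|c l|) *: z i)); last first.
    by move=> l _; rewrite gE// divnMDl// divn_small// addn0.
  by rewrite -scaler_suml -mulr_sumr c1 mulr1.
apply: (le_trans low); apply: (le_trans (zx _ _)); rewrite -mulrA.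
have hB : `|lincomb B (n * m) g| <= T * (G * dl).
  rewrite gsum (le_trans (ler_norm_sum _ _ _))// mulr_suml; apply: ler_sum => i _.
  by rewrite normrZ ler_wpM2l.
have hx := xB _ _ _ gM.
have hn : `|lincomb x (n * m) g| <= K * M + T * (G * dl).
  rewrite -(subrK (lincomb B (n * m) g) (lincomb x _ g)).
  by rewrite (le_trans (ler_normD _ _))// lerD.
apply: (le_trans (ler_wpM2l (ltW D0) hn)); rewrite mulrDr lerD2l.
have -> : D * (T * (G * dl)) = eps * (D * (T * G) / (D * (T * G) + 1)).
  by rewrite /dl; field; rewrite gt_eqF.
by rewrite ler_piMr ?(ltW eps0)// ler_pdivrMr// mul1r lerDl.
Qed.
End Incomparability.

(** * Sequences equivalent to [z] with zero escaping mass *)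

Section ZeroMass.
Variables (R : realType) (X E : completeNormedModType R).
Variables (e : nat -> X) (z : nat -> E) (coef : X -> nat -> R) (C : R).
Hypothesis hb : homogeneous_basis e z coef C.
Variable U : set_system nat.
Hypothesis UU : UltraFilter U.
Hypothesis Uoo : \oo `<=` U.

Let C0 : 0 < C := hb_gt0 hb.

Lemma dominated_bound (x : nat -> X) (D : R) :
  (forall n a, `|lincomb x n a| <= D * `|lincomb z n a|) ->
  forall k, `|x k| <= D * `|z 0|.
Proof.
move=> xz k; rewrite -(one_spreading_term (hb_spreading hb) k) -(lincomb_delta x)
  -(lincomb_delta z).
exact: xz.
Qed.

(** The sums V + A_0 + ... + A_(n-1) are bounded uniformly in n and the A_j admit multipliers, so in
    a combination everything outside the blocks B_l is controlled by the tail sums. This is the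
    decomposition required by [summing_of_decomposition]. *)
Lemma zero_mass_summing (x : nat -> X) (D : R) : 0 < D ->
  (forall n a, `|lincomb x n a| <= D * `|lincomb z n a|) ->
  (forall n a, `|lincomb z n a| <= D * `|lincomb x n a|) ->
  escaping_mass coef U x 0 ->
  exists2 K : R, 0 < K & forall n d M, tails_le n d M -> `|lincomb z n d| <= K * M.
Proof.
move=> D0 xz zx x0.
have [p [k [kappa [a [alpha [b [[ps ks km kE k0] [al0 bb est]]]]]]]] :=
  escaping_mass_structure hb UU Uoo x0 ltr01.
have pm : {homo p : i j / (i <= j)%N}.
  by apply: homo_leq => [//|? ? ?|i]; [exact: leq_trans | exact/ltnW/ps].
set AA := fun j => \sum_(p j <= i < p j.+1) alpha i *: e i in est.
set BB := fun j => \sum_(p j <= i < p j.+1) b i *: e i in est.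
pose V := lincomb e (p 0%N) a.
(* The first term bounds [x (k n)]; the 1 is the structure error for a unit coefficient, with
   [eta = 1]. *)
pose B0 := D * `|z 0%N| + 1.
have B00 : 0 <= B0 by rewrite addr_ge0// mulr_ge0// ltW.
(* Adding the block [BB n] gives [x (k n)] up to an error 1, and a basis projection removes that
   block again. *)
have headB n : `|V + \sum_(j < n) AA j| <= C * B0.
  pose f i := if (i < p 0)%N then a i else if (i < p n)%N then alpha i else b i.
  have hV : \sum_(0 <= i < p 0) f i *: e i = V.
    rewrite /V lincomb_nat; apply: eq_big_nat => i /andP[_ i0]; by rewrite /f i0.
  have hA : \sum_(p 0 <= i < p n) f i *: e i = \sum_(j < n) AA j.
    rewrite -big_blocks//; apply: eq_big_nat => i /andP[i0 iN].
    by rewrite /f ltnNge i0/= iN.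
  have hB : \sum_(p n <= i < p n.+1) f i *: e i = BB n.
    apply: eq_big_nat => i /andP[iN _].
    by rewrite /f ltnNge (leq_trans (pm 0%N n _) iN)//= ltnNge iN.
  have vE : V + \sum_(j < n) AA j = lincomb e (p n) f.
    by rewrite lincomb_nat (@big_cat_nat _ _ _ (p 0%N) 0 (p n))/= ?pm// hV hA.
  have wE : V + \sum_(j < n) AA j + BB n = lincomb e (p n.+1) f.
    by rewrite vE !lincomb_nat (@big_cat_nat _ _ _ (p n) 0 (p n.+1))/= ?pm// hB.
  have -> : V + \sum_(j < n) AA j = lincomb e (p n) (coef (lincomb e (p n.+1) f)).
    rewrite vE; apply: eq_bigr => i _.
    by rewrite (hb_coef hb) (leq_trans (ltn_ord i))// pm.
  apply: (le_trans (hb_bounded hb _ _)); rewrite ler_wpM2l ?(ltW C0)// -wE.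
  pose dl l : R := (l == n)%:R.
  have t1 : tails_le n.+1 dl 1.
    move=> j; rewrite big_mkcond big_ord_recr/= big1 ?add0r; last first.
      by move=> i _; rewrite /dl ltn_eqF//; case: ifP.
    by rewrite /dl eqxx; case: ifP; rewrite ?normr1 ?normr0.
  have := est n.+1 dl 1 t1.
  have -> : \sum_(l < n.+1) dl l *: x (k l) = x (k n) by exact: (lincomb_delta (x \o k)).
  have s1 (P : pred nat) : P n -> \sum_(l < n.+1 | P l) dl l = 1.
    move=> Pn; rewrite big_mkcond big_ord_recr/= Pn big1 ?add0r; first by rewrite /dl eqxx.
    by move=> i _; rewrite /dl ltn_eqF//; case: ifP.
  rewrite (s1 xpredT)// scale1r mulr1 big_split/=.
  rewrite (_ : \sum_(i < n.+1) dl i *: BB i = BB n); last exact: lincomb_delta.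
  rewrite big_ord_recr/= [X in X *: AA n]big_pred0; last first.
    by move=> l; rewrite ltnNge -ltnS ltn_ord.
  rewrite scale0r addr0 (eq_bigr (fun j : 'I_n => AA j)); last first.
    by move=> j _; rewrite (s1 (fun l => j < l)%N)// scale1r.
  rewrite addrA -/V => h.
  rewrite -(subKr (x (k n)) (_ + BB n)) (le_trans (ler_normB _ _))// lerD//.
  exact: dominated_bound.
(* The terms stand for the structure error, the part V, and the A_j with tail sums as
   multipliers. *)
pose K := 1 + C * B0 + 2 * (C * (2 * (C * B0))).
have CB0 : 0 <= C * B0 by rewrite mulr_ge0// ltW.
have K0 : 0 < K.
  rewrite /K -addrA; apply: ltr_pwDl ltr01 _; apply: addr_ge0 => //.
  by apply: mulr_ge0 => //; apply: mulr_ge0 (ltW C0) _; exact: mulr_ge0.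
have AB n : `|\sum_(j < n) AA j| <= 2 * (C * B0).
  have h0 := headB 0%N; rewrite big_ord0 addr0 in h0.
  rewrite -(addKr V (\sum_(j < n) _)) addrC (le_trans (ler_normB _ _))//.
  by rewrite mulr2n mulrDl mul1r lerD.
have dec n c M : tails_le n c M ->
    `|lincomb (x \o k) n c - lincomb BB n c| <= K * M.
  move=> cM; have M0 : 0 <= M by apply: le_trans (cM 0%N).
  have := est n c M cM; rewrite mul1r big_split/= addrA.
  set t := fun j => \sum_(l < n | (j < l)%N) c l.
  set Y := (X in `|_ - (X + _)|) => h.
  have YM : `|Y| <= C * B0 * M + 2 * (C * (2 * (C * B0))) * M.
    rewrite /Y (le_trans (ler_normD _ _))// lerD//.
      rewrite normrZ mulrC ler_pM//; last exact: (cM 0%N).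
      by have := headB 0%N; rewrite big_ord0 addr0.
    have := @block_multipliers _ _ _ e z coef C hb p kappa alpha n (fun=> 1) t M
      pm km kE al0 M0 (fun j => cM j.+1).
    rewrite (eq_bigr (fun j : 'I_n => t j *: AA j)) => [|j _]; last by rewrite mulr1.
    rewrite [X in _ <= 2 * (C * `|X|) * M](eq_bigr (fun j : 'I_n => AA j)) => [h1|j _];
      last by rewrite scale1r.
    apply: (le_trans h1); rewrite ler_wpM2r// ler_wpM2l// ler_wpM2l ?(ltW C0)//.
    exact: AB.
  have -> : lincomb (x \o k) n c - lincomb BB n c =
      (\sum_(l < n) c l *: x (k l) - (Y + \sum_(l < n) c l *: BB l)) + Y.
    by clearbody Y; rewrite opprD addrA addrAC subrK.
  rewrite (le_trans (ler_normD _ _))//.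
  rewrite (_ : K * M = M + (C * B0 * M + 2 * (C * (2 * (C * B0))) * M)); last by rewrite /K;
    ring.
  exact: lerD.
have abs n c : `|lincomb BB n (fun j => `|c j|)| <= 2 * C * `|lincomb BB n c|.
  have := @block_multipliers _ _ _ e z coef C hb p kappa b n c (fun j => Num.sg (c j)) 1 pm km
    kE bb ler01.
  rewrite mulr1 -mulrA => /(_ _) h; apply: le_trans (h _).
    by under eq_bigr do rewrite -normrEsg.
  by move=> j; rewrite normr_sg; case: (_ != _).
exists (D * K); first exact: mulr_gt0.
have kb n i : (i < n)%N -> (k i < (\max_(j < n) k j).+1)%N.
  by move=> ni; rewrite ltnS (leq_bigmax (Ordinal ni)).
apply: (@summing_of_decomposition _ _ _ e z coef C hb (x \o k) BB D K (2 * C)) => //.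
- by rewrite mulr_gt0.
- move=> n c; rewrite (hb_spreading hb ks) /lincomb.
  rewrite !(lincomb_reindex _ c (kb n)); exact: zx.
- by move=> n c; exact: (spread_subsequence_le hb ks xz).
Qed.

End ZeroMass.

(** * The decomposition *)

Lemma lincomb_summing_basis (R : realType) n (a : nat -> R) k :
  lincomb (@summing_basis R) n a k = \sum_(i < n | (k <= i)%N) a i.
Proof.
rewrite /lincomb fct_sumE [RHS]big_mkcond/=; apply: eq_bigr => i _.
transitivity (a i * summing_basis R i k); first by [].
rewrite /summing_basis fct_sumE; case: leqP => [ki|ik].
  rewrite (bigD1 (Ordinal (ki : k < i.+1)%N))//= /delta eqxx big1 ?addr0 ?mulr1// => j.
  by rewrite -val_eqE/= eq_sym => /negbTE ->.
by rewrite big1 ?mulr0// => j _; rewrite /delta gtn_eqF// (leq_trans (ltn_ord j)).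
Qed.

(** The c_0 norm of a combination of the summing basis is the supremum of its tail sums, so the two
    estimates are the two halves of the equivalence. *)
Lemma summing_equivalent (R : realType) (E : normedModType R) (z : nat -> E) (C K : R) :
  0 < C -> 0 < K ->
  (forall n (a : nat -> R) j, `|\sum_(i < n | (j <= i)%N) a i| <= C * `|lincomb z n a|) ->
  (forall n d M, tails_le n d M -> `|lincomb z n d| <= K * M) ->
  seq_equivalent (fun v : E => `|v|) z (@c0_norm R) (@summing_basis R).
Proof.
move=> C0 K0 tC zK; exists K^-1, C; split=> //; first by rewrite invr_gt0.
move=> n a; split; last first.
  apply: ge_sup => [|_ [k _ <-]]; first by exists `|lincomb (@summing_basis R) n a 0%N|, 0%N.
  by rewrite lincomb_summing_basis.
rewrite mulrC ler_pdivrMr// mulrC; apply: zK => j; rewrite -lincomb_summing_basis.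
apply: ub_le_sup; last by exists j.
by exists (C * `|lincomb z n a|) => _ [k _ <-]; rewrite lincomb_summing_basis.
Qed.

Lemma free_ultrafilter_nat : exists2 U : set_system nat, UltraFilter U & \oo `<=` U.
Proof. by have [U [UU h]] := @ultraFilterLemma nat \oo _; exists U. Qed.

(** * Convex blocks of escaping mass one *)

Section EscapingBlocks.
Variables (R : realType) (X E : completeNormedModType R).
Variables (e : nat -> X) (z : nat -> E) (coef : X -> nat -> R) (C : R).
Hypothesis hb : homogeneous_basis e z coef C.
Variable U : set_system nat.
Hypothesis UU : UltraFilter U.
Hypothesis Uoo : \oo `<=` U.

(** The supports run off to infinity, so every coordinate tends to 0 while each total sum stays
    1. *)
Lemma escaping_blocks : exists w : nat -> X,
  (forall n a, `|lincomb w n a| <= C * `|lincomb z n a|) /\ escaping_mass coef U w 1.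
Proof.
have [q [c [qs q0 c1 wC]]] := hb_blocks hb.
pose w k := \sum_(q k <= i < q k.+1) c i *: e i; exists w; split=> //.
have qk k : (k <= q k)%N.
  by elim: k => [//|k IH]; apply: leq_ltn_trans IH _; exact: qs.
have qm k : (q k <= q k.+1)%N by exact/ltnW/qs.
pose f k i := if (q k <= i)%N then c i else 0.
have wE k : w k = lincomb e (q k.+1) (f k).
  rewrite lincomb_nat (@big_cat_nat _ _ _ (q k) 0 (q k.+1))//= big_nat big1 ?add0r.
    by apply: eq_big_nat => i /andP[ki _]; rewrite /f ki.
  by move=> i /andP[_ ik]; rewrite /f leqNgt ik scale0r.
have wc k i : coef (w k) i = if (i < q k.+1)%N then f k i else 0.
  by rewrite wE (hb_coef hb).
have wt k : total_sum coef (w k) = 1.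
  apply: cvg_lim => //; apply: cvg_near_cst; exists (q k.+1) => // m /= km.
  rewrite /partial_sum -(big_mkord xpredT (coef (w k))).
  rewrite (@big_cat_nat _ _ _ (q k.+1) 0 m)//= [X in _ + X]big_nat [X in _ + X]big1 ?addr0.
    rewrite (@big_cat_nat _ _ _ (q k) 0 (q k.+1))//= big_nat big1 ?add0r => [|i /andP[_ ik]].
      rewrite -(c1 k); apply: eq_big_nat => i /andP[ki ik].
      by rewrite wc ik /f ki.
    by rewrite wc /f (leqNgt (q k)) ik /=; case: ifP.
  by move=> i /andP[ki _]; rewrite wc ltnNge ki.
exists (fun=> 0), 0, 1; split.
- move=> i; apply: cvg_near_cst; apply: Uoo; exists i.+1 => // k /= ik.
  by rewrite wc /f (leqNgt (q k)) (leq_trans ik (qk k))/=; case: ifP.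
- by under eq_fun do rewrite big1//; exact: cvg_cst.
- by under eq_fun do rewrite wt; exact: cvg_cst.
- by rewrite subr0.
Qed.
End EscapingBlocks.

(** The complementation clause is stated for both summands; by exclusivity exactly one of the two
    implications has a true premise. *)
Theorem theorem6 (R : realType) (X : completeNormedModType R) (e : nat -> X)
    (E : completeNormedModType R) (z : nat -> E) (Y W : set X) :
  conditional_spreading_basis e ->
  convex_block_homogeneous_part e z ->
  ~ seq_equivalent (fun v : E => `|v|) z (@c0_norm R) (@summing_basis R) ->
  direct_sum Y W ->
  let Z := closed_span z in
  ((contains_copy Y Z /\ ~ contains_copy W Z) \/
   (contains_copy W Z /\ ~ contains_copy Y Z)) /\
  (contains_copy Y Z -> contains_complemented_copy Y Z) /\
  (contains_copy W Z -> contains_complemented_copy W Z).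
Proof.
move=> eS ez nsum YW Z.
have [coef [C hb]] := homogeneous_basis_exists eS ez.
have C0 := hb_gt0 hb.
have [U UU Uoo] := free_ultrafilter_nat.
have [P [Cp [Plin Cp0 Pb PY [PW PYid PW0]]]] := direct_sum_projection YW.
have [sY sW _ _] := YW.
have P0 : P 0 = 0 by have := Plin (-1) 0 0; rewrite scaler0 addr0 scaleN1r addNr.
have PE (x : nat -> X) n a : lincomb (P \o x) n a = P (lincomb x n a).
  elim: n => [|n IH]; first by rewrite /lincomb !big_ord0 P0.
  rewrite /lincomb !big_ord_recr/= addrC [in RHS]addrC Plin.
  by congr (_ + _).
have Qb x : `|x - P x| <= (1 + Cp) * `|x|.
  by rewrite (le_trans (ler_normB _ _))// mulrDl mul1r lerD2l.
have nzero (x : nat -> X) (D : R) : 0 < D ->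
    (forall n a, `|lincomb x n a| <= D * `|lincomb z n a|) ->
    (forall n a, `|lincomb z n a| <= D * `|lincomb x n a|) ->
    ~ escaping_mass coef U x 0.
  move=> D0 xz zx x0; have [K K0 HK] := zero_mass_summing hb UU Uoo D0 xz zx x0.
  exact: nsum (summing_equivalent C0 K0 (hb_tail hb) HK).
have copy_of (A : set X) : contains_complemented_copy A Z -> contains_copy A Z.
  by move=> [Z' Z'A [? ? _]]; exists Z'.
have incomp : contains_copy Y Z -> contains_copy W Z -> False.
  move=> /copy_sequence[x [C1 [C10 xY xz zx]]] /copy_sequence[x' [C2 [C20 xW xz' zx']]].
  have [b xb] := escaping_mass_exists hb UU (dominated_bound hb xz).
  have [b' xb'] := escaping_mass_exists hb UU (dominated_bound hb xz').
  have [b0|b0] := eqVneq b 0; first by rewrite b0 in xb; exact: (nzero _ _ C10 xz zx xb).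
  (* [s] cancels the masses. The new sequence still dominates [z], because [1 - P] sends it to [x']:
     the summand from [x] lies in Y and that from [x'] in W. *)
  pose s := - b' / b.
  have := escaping_mass_linear hb UU s xb xb'.
  have -> : s * b + b' = 0 by rewrite /s divfK// addNr.
  have lE n a : lincomb (fun k => s *: x k + x' k) n a = s *: lincomb x n a + lincomb x' n a.
    rewrite /lincomb scaler_sumr -big_split/=; apply: eq_bigr => i _.
    by rewrite scalerDr !scalerA mulrC.
  apply: (nzero _ (`|s| * C1 + C2 + C2 * (1 + Cp))).
  - apply: addr_gt0; last by rewrite mulr_gt0// addr_gt0.
    by apply: ltr_wpDl => //; apply: mulr_ge0 (ltW C10).
  - move=> n a; rewrite lE (le_trans (ler_normD _ _))// normrZ !mulrDl -addrA lerD//.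
      by rewrite -mulrA ler_wpM2l.
    apply: (le_trans (xz' n a)); rewrite lerDl -mulrA.
    by apply: mulr_ge0 (ltW C20) _; apply: mulr_ge0 => //; apply: addr_ge0 (ltW Cp0).
  - move=> n a; rewrite lE; set v := s *: _ + _.
    have vE : v - P v = lincomb x' n a.
      by rewrite /v Plin PYid// PW0// addr0 addrAC subrr add0r.
    apply: (le_trans (zx' n a)); rewrite -vE.
    apply: (@le_trans _ _ (C2 * ((1 + Cp) * `|v|))); first by rewrite ler_wpM2l// ltW.
    rewrite mulrA ler_wpM2r// lerDr; apply: addr_ge0 (ltW C20).
    by apply: mulr_ge0 (ltW C10).
have [w [wz w1]] := escaping_blocks hb UU Uoo.
pose w' k := w k - P (w k).
have Pwz n a : `|lincomb (P \o w) n a| <= Cp * C * `|lincomb z n a|.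
  by rewrite PE (le_trans (Pb _))// -mulrA ler_wpM2l// ltW.
have w'z n a : `|lincomb w' n a| <= (1 + Cp) * C * `|lincomb z n a|.
  have -> : lincomb w' n a = lincomb w n a - P (lincomb w n a).
    rewrite -PE /lincomb -sumrB; apply: eq_bigr => i _; by rewrite /w' scalerBr.
  by rewrite (le_trans (Qb _))// -mulrA ler_wpM2l// addr_ge0// ltW.
have [b wb] := escaping_mass_exists hb UU (dominated_bound hb Pwz).
have [b' wb'] := escaping_mass_exists hb UU (dominated_bound hb w'z).
(* Linearity and uniqueness of the mass, applied to w = P w + (w - P w). *)
have bb' : b + b' = 1.
  have := escaping_mass_linear hb UU 1 wb wb'; rewrite mul1r.
  under [X in escaping_mass _ _ X _ -> _]eq_fun do rewrite scale1r /w' /= subrKC.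
  by move=> h; exact: (escaping_mass_unique UU h w1).
have [b0|b0] := eqVneq b 0.
  have b'0 : b' != 0 by move: bb'; rewrite b0 add0r => ->; exact: oner_neq0.
  have ccW : contains_complemented_copy W Z.
    apply: (escaping_mass_copy hb UU Uoo sW _ _ w'z wb' b'0) => [k|]; first exact: PW.
    by rewrite mulr_gt0// addr_gt0.
  by split; [right; split; [exact: copy_of | move=> cY; exact: incomp cY (copy_of _ ccW)]
    | split=> // cY; have := incomp cY (copy_of _ ccW)].
have ccY : contains_complemented_copy Y Z.
  apply: (escaping_mass_copy hb UU Uoo sY _ _ Pwz wb b0) => [k|]; first exact: PY.
  by rewrite mulr_gt0.
by split; [left; split; [exact: copy_of | exact: incomp (copy_of _ ccY)]
  | split=> // cW; have := incomp (copy_of _ ccY) cW].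
Qed.
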